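(* Let $n\ge1$. The full strongly exceptional collection $\{\mathcal L_{\operatorname{BP}(\Omega)}\}$ of nef line bundles on $\operatorname{Perm}_n$, indexed by the loopless Schubert matroids $\Omega$ on $[n]$, is $S_2\times S_n$-invariant.
   Context: Work over an algebraically closed field of characteristic $0$. Let $N=\mathbb Z^n/\mathbb Z\mathbf 1$, $M=\{x\in\mathbb Z^n:\sum x_i=0\}$. The braid fan in $N_{\mathbb R}$ has maximal cones the closures of the chambers of the arrangement $\{x_i=x_j\}$, with rays spanned by $e_S=\sum_{i\in S}e_i$, $\emptyset\ne S\subsetneq[n]$; $\operatorname{Perm}_n$ is its toric variety. The group $S_2\times S_n$ acts on the fan, hence on $\operatorname{Perm}_n$: $S_n$ permutes coordinates of $N$ and the non-identity element of $S_2$ acts by $x\mapsto-x$. For a lattice polytope $P\subset\mathbb R^n$ with all edges parallel to vectors $e_i-e_j$, $\mathcal L_P=\mathcal O(\sum_Sa_SD_S)$ where $a_S=\max_{x\in P'}\sum_{i\in S}x_i$, $P'$ is any $\mathbb Z^n$-translate of $P$ contained in $M_{\mathbb R}$, and $D_S$ is the divisor of the ray of $e_S$ (well defined up to isomorphism). A collection of sheaves $\{\mathcal E_i\}$ is invariant under a group $G$ acting on the variety if for all $g\in G$ and all $i$, the sheaf $g\cdot\mathcal E_i$ (transport of $\mathcal E_i$ along the automorphism $g$) is isomorphic to some $\mathcal E_j$ in the collection. Schubert matroids: for $w\in S_n$ let $\le_w$ be the induced linear order on $[n]$ and the Gale order on $k$-subsets: $\{i_1<_w\dots<_wi_k\}\le_w\{j_1<_w\dots<_wj_k\}$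 iff $i_a\le_wj_a$ for all $a$. For $|S|=k$, $\Omega_S^w$ is the matroid with bases $\{T\in\binom{[n]}k:S\le_wT\}$; Schubert matroids are the matroids of this form. Loopless means every element lies in some basis. $\operatorname{BP}(\Omega)=\operatorname{conv}(e_B:B\text{ a basis of }\Omega)$. *)

(* Defs.v *)
From HB Require Import structures.
From mathcomp Require Import all_boot all_order all_algebra all_fingroup.
From mathcomp Require Import all_classical all_reals topology_structure.
From mathcomp Require Import zify.

Set Implicit Arguments.
Unset Strict Implicit.
Unset Printing Implicit Defensive.

Import Order.TTheory GRing.Theory Num.Theory.
Local Open Scope classical_set_scope.
Local Open Scope ring_scope.

(* Varieties over an algebraically closed field k in the classical style: a
   topological space of (closed) points with a sheaf of k-valued functions. *)

Record opens (X : topologicalType) := Opens {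
  opens_set :> set X;
  opens_open : open opens_set }.

Definition incl (T : Type) (A B : set T) (s : A `<=` B) (x : A) : B :=
  exist _ (val x) (mem_set (s _ (set_mem (valP x)))).

Record fspace (k : fieldType) := FSpace {
  pts :> topologicalType;
  reg : forall U : opens pts, set (U -> k);
  reg_cst : forall (U : opens pts) c, reg (fun _ : opens_set U => c);
  reg_sub : forall (U : opens pts) (f g : U -> k), reg f -> reg g -> reg (f - g);
  reg_mul : forall (U : opens pts) (f g : U -> k), reg f -> reg g -> reg (f * g);
  reg_res : forall (U V : opens pts) (s : U `<=` V) (f : V -> k),
    reg f -> reg (f \o incl s);
  reg_local : forall (U : opens pts) (f : U -> k),
    (forall x : U, exists (V : opens pts) (s : V `<=` U),
        opens_set V (val x) /\ reg (f \o incl s)) ->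
    reg f }.

Section StructureSheaf.
Variables (k : fieldType) (X : fspace k).
Implicit Types U V W : opens X.

Definition reg_pred U : {pred (U -> k)} := [pred f | f \in @reg k X U].

Lemma reg_pred_subring U : subring_closed (@reg_pred U).
Proof.
split=> [|f g|f g]; rewrite !inE; [exact: reg_cst|exact: reg_sub|exact: reg_mul].
Qed.

HB.instance Definition _ U :=
  GRing.isSubringClosed.Build (U -> k) (@reg_pred U) (@reg_pred_subring U).

Record OX U := Regular { OX_fun :> U -> k; OX_reg : OX_fun \in @reg_pred U }.

HB.instance Definition _ U := [isSub for @OX_fun U].
HB.instance Definition _ U := [Choice of OX U by <:].
HB.instance Definition _ U := GRing.SubChoice_isSubComPzRing.Build
  (U -> k) (@reg_pred U) (OX U) (GRing.subringClosedP _).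

Lemma OX_res_subproof U V (s : U `<=` V) (f : OX V) :
  (OX_fun f) \o incl s \in @reg_pred U.
Proof. by rewrite inE; apply: reg_res; have := OX_reg f; rewrite inE. Qed.

Definition OX_res U V (s : U `<=` V) (f : OX V) : OX U :=
  Regular (OX_res_subproof s f).

Record modsheaf := ModSheaf {
  sec :> forall U, lmodType (OX U);
  res : forall U V (s : U `<=` V), sec V -> sec U;
  res_add : forall U V (s : U `<=` V) (x y : sec V),
    res s (x + y) = res s x + res s y;
  res_scale : forall U V (s : U `<=` V) (a : OX V) (x : sec V),
    res s (a *: x) = OX_res s a *: res s x;
  res_id : forall U (s : U `<=` U) (x : sec U), res s x = x;
  res_comp : forall U V W (s : U `<=` V) (t : V `<=` W) (st : U `<=` W)
    (x : sec W), res s (res t x) = res st x;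
  res_sep : forall U (I : Type) (C : I -> opens X) (s : forall i, C i `<=` U),
    U `<=` \bigcup_i C i -> forall x y : sec U,
    (forall i, res (s i) x = res (s i) y) -> x = y;
  res_glue : forall U (I : Type) (C : I -> opens X) (s : forall i, C i `<=` U),
    U `<=` \bigcup_i C i -> forall x : (forall i, sec (C i)),
    (forall i j W (si : W `<=` C i) (sj : W `<=` C j),
        res si (x i) = res sj (x j)) ->
    exists y : sec U, forall i, res (s i) y = x i }.

Definition modsheaf_iso (F G : modsheaf) : Prop :=
  exists theta : forall U, {linear F U -> G U},
    (forall U, bijective (theta U)) /\
    (forall U V (s : U `<=` V) (x : F V), theta U (res s x) = res s (theta V x)).

End StructureSheaf.

Arguments res {k X} _ {U V} s x.

Definition restrict_scalars (A B : pzRingType) (f : {rmorphism A -> B})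
  (M : lmodType B) : Type := M.

Section RestrictScalars.
Variables (A B : pzRingType) (f : {rmorphism A -> B}) (M : lmodType B).
Local Notation fM := (restrict_scalars f M).
HB.instance Definition _ := GRing.Zmodule.copy fM M.
Let scale (a : A) (x : fM) : fM := f a *: (x : M).
Let scaleA a b x : scale a (scale b x) = scale (a * b) x.
Proof. by rewrite /scale rmorphM scalerA. Qed.
Let scale1 : left_id 1 scale.
Proof. by move=> x; rewrite /scale rmorph1 scale1r. Qed.
Let scaleDr : right_distributive scale +%R.
Proof. by move=> a x y; rewrite /scale scalerDr. Qed.
Let scaleDl x : {morph scale^~ x : a b / a + b}.
Proof. by move=> a b; rewrite /scale rmorphD scalerDl. Qed.
HB.instance Definition _ :=
  GRing.Zmodule_isLmodule.Build A fM scaleA scale1 scaleDr scaleDl.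
End RestrictScalars.

Definition preimage_map (S T : Type) (f : S -> T) (A : set T)
  (x : f @^-1` A) : A := exist _ (f (val x)) (mem_set (set_mem (valP x))).

Definition opens_preim (X : topologicalType) (f : X -> X)
  (fc : forall U : set X, open U -> open (f @^-1` U)) (U : opens X) : opens X :=
  Opens (fc U (opens_open U)).

Record automorphism (k : fieldType) (X : fspace k) := Automorphism {
  aut_fun :> X -> X;
  aut_inv : X -> X;
  aut_funK : cancel aut_fun aut_inv;
  aut_invK : cancel aut_inv aut_fun;
  aut_cont : forall U : set X, open U -> open (aut_fun @^-1` U);
  aut_inv_cont : forall U : set X, open U -> open (aut_inv @^-1` U);
  aut_reg : forall (U : opens X) (f : U -> k), reg f ->
    reg (U := opens_preim aut_cont U) (f \o @preimage_map _ _ aut_fun U);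
  aut_inv_reg : forall (U : opens X) (f : U -> k), reg f ->
    reg (U := opens_preim aut_inv_cont U) (f \o @preimage_map _ _ aut_inv U) }.

Section Transport.
Variables (k : fieldType) (X : fspace k) (g : automorphism X).
Implicit Types U V W : opens X.

Local Notation pre := (opens_preim (aut_cont g)).

Lemma aut_pull_subproof U (f : OX U) :
  (OX_fun f) \o @preimage_map _ _ g U \in @reg_pred k X (pre U).
Proof. by rewrite inE; apply: aut_reg; have := OX_reg f; rewrite inE. Qed.

Definition aut_pull U (f : OX U) : OX (pre U) := Regular (aut_pull_subproof f).

Lemma aut_pull_zmod U : zmod_morphism (@aut_pull U).
Proof. by move=> a b; apply: val_inj. Qed.

Lemma aut_pull_monoid U : monoid_morphism (@aut_pull U).
Proof. by split=> [|a b]; apply: val_inj. Qed.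

HB.instance Definition _ U :=
  GRing.isZmodMorphism.Build _ _ (@aut_pull U) (@aut_pull_zmod U).
HB.instance Definition _ U :=
  GRing.isMonoidMorphism.Build _ _ (@aut_pull U) (@aut_pull_monoid U).

Variable F : modsheaf X.

(* The direct image of F by g: its sections on U are those of F on the preimage
   of U, and a in O(U) acts through a \o g. *)
Definition transport_sec U : lmodType (OX U) :=
  restrict_scalars (@aut_pull U) (F (pre U)).

Lemma pre_sub U V : U `<=` V -> pre U `<=` pre V.
Proof. by move=> s x; exact: s. Qed.

Definition transport_res U V (s : U `<=` V) (x : transport_sec V) :
  transport_sec U := res F (pre_sub s) x.

Lemma transport_add U V (s : U `<=` V) (x y : transport_sec V) :
  transport_res s (x + y) = transport_res s x + transport_res s y.
Proof. exact: res_add. Qed.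

Lemma transport_scale U V (s : U `<=` V) (a : OX V) (x : transport_sec V) :
  transport_res s (a *: x) = OX_res s a *: transport_res s x.
Proof.
have e : OX_res (pre_sub s) (aut_pull a) = aut_pull (OX_res s a).
  apply: val_inj; apply/funext => y /=.
  by congr (OX_fun a _); apply: val_inj.
apply: etrans (res_scale (pre_sub s) (aut_pull a) x) _.
by rewrite e.
Qed.

Lemma transport_id U (s : U `<=` U) (x : transport_sec U) :
  transport_res s x = x.
Proof. exact: res_id. Qed.

Lemma transport_comp U V W (s : U `<=` V) (t : V `<=` W) (st : U `<=` W)
  (x : transport_sec W) : transport_res s (transport_res t x) = transport_res st x.
Proof. exact: res_comp. Qed.

Lemma transport_cover U (I : Type) (C : I -> opens X) :
  U `<=` \bigcup_i C i -> pre U `<=` \bigcup_i pre (C i).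
Proof. by move=> cov x /cov [i _ Cx]; exists i. Qed.

Lemma transport_sep U (I : Type) (C : I -> opens X) (s : forall i, C i `<=` U) :
  U `<=` \bigcup_i C i -> forall x y : transport_sec U,
  (forall i, transport_res (s i) x = transport_res (s i) y) -> x = y.
Proof.
move=> cov x y xy.
exact: (res_sep (C := fun i => pre (C i)) (transport_cover cov) xy).
Qed.

Lemma transport_glue U (I : Type) (C : I -> opens X)
    (s : forall i, C i `<=` U) :
  U `<=` \bigcup_i C i -> forall x : (forall i, transport_sec (C i)),
  (forall i j W (si : W `<=` C i) (sj : W `<=` C j),
      transport_res si (x i) = transport_res sj (x j)) ->
  exists y : transport_sec U, forall i, transport_res (s i) y = x i.
Proof.
move=> cov x xx.
apply: (res_glue (C := fun i => pre (C i)) (fun i => pre_sub (s i))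
  (transport_cover cov)) => i j W si sj.
pose W' := opens_preim (aut_inv_cont g) W.
have sW' l (sl : W `<=` pre (C l)) : W' `<=` C l.
  by move=> z /= /sl; rewrite /= aut_invK.
have sW : W `<=` pre W' by move=> z Wz /=; rewrite /= aut_funK.
rewrite -(res_comp sW (pre_sub (sW' i si)) si).
rewrite -(res_comp sW (pre_sub (sW' j sj)) sj).
by congr (res F sW _); exact: (xx i j W').
Qed.

Definition transport : modsheaf X :=
  ModSheaf transport_add transport_scale transport_id transport_comp
    transport_sep transport_glue.

End Transport.

Definition invariant_collection (k : fieldType) (X : fspace k) (G : Type)
    (act : G -> automorphism X) (I : Type) (E : I -> modsheaf X) : Prop :=
  forall (g : G) (i : I), exists j : I, modsheaf_iso (transport (act g) (E i)) (E j).

(* Subsets of N_R = R^n / R(1,..,1) are given by their preimages in R^n, and M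
   is the set of integer vectors with zero sum. *)

Section BraidFan.
Variables (R : realType) (n : nat).

Definition pairing (m : 'rV[int]_n) (x : 'rV[R]_n) : R :=
  \sum_i (m 0 i)%:~R * x 0 i.

Definition latticeM : set 'rV[int]_n := [set m | \sum_i m 0 i = 0].

(* The lattice points of the dual cone *)
Definition dual_cone (sigma : set 'rV[R]_n) : set 'rV[int]_n :=
  [set m | latticeM m /\ forall x, sigma x -> 0 <= pairing m x].

Definition perp (sigma : set 'rV[R]_n) : set 'rV[int]_n :=
  [set m | latticeM m /\ forall x, sigma x -> pairing m x = 0].

(* The order w 0 < w 1 < ... < w (n-1) *)
Definition lew (w : 'S_n) : rel 'I_n := [rel i j | ((w^-1)%g i <= (w^-1)%g j)%N].

Definition chamber (w : 'S_n) : set 'rV[R]_n :=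
  [set x | forall i j, lew w i j -> x 0 j <= x 0 i].

(* The faces of the chambers, cut out by supporting hyperplanes *)
Definition braid_fan : set (set 'rV[R]_n) :=
  [set sigma | exists (w : 'S_n) (m : 'rV[int]_n), dual_cone (chamber w) m /\
     sigma = chamber w `&` [set x | pairing m x = 0]].

Definition indic (S : {set 'I_n}) : 'rV[R]_n := \row_i (i \in S)%:R.

Definition proper_subset (S : {set 'I_n}) : bool :=
  (S != finset.set0) && (S != [set: 'I_n]%SET).

Definition ray (S : {set 'I_n}) : set 'rV[R]_n :=
  [set x | exists c d : R, 0 <= c /\ x = c *: indic S + const_mx d].

Definition zero_cone : set 'rV[R]_n := [set const_mx d | d in setT].

End BraidFan.

Arguments chamber R {n} w.
Arguments ray R {n} S.
Arguments zero_cone R n : clear implicits.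

(* The odd element of S_2 acts by -1, and S_n by e_i |-> e_(g.2 i). *)
Definition gact (A : pzRingType) (n : nat) (g : 'S_2 * 'S_n) (x : 'rV[A]_n) :
  'rV[A]_n := \row_i ((-1) ^+ odd_perm g.1 * x 0 (g.2^-1 i)%g).

Section Perm.
Variables (R : realType) (k : fieldType) (n : nat).

(* A point of the affine chart U_sigma is a monoid morphism from the additive
   monoid dual_cone sigma to the multiplicative monoid k.  Every point of the
   variety lies in a smallest chart, the one for which the characters that do
   not vanish at the point are exactly those in the orthogonal of sigma; this
   cone and the morphism on its dual, extended by 0, are the data of a point.
   So [pval x m] is the value at x of the character chi^m when that character
   is regular at x, and U_sigma consists of the x with [pcone x] in sigma. *)
Record perm_point := PermPoint {
  pcone : set 'rV[R]_n;
  pval : 'rV[int]_n -> k;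
  pcone_fan : braid_fan pcone;
  pval0 : pval 0 = 1;
  pvalD : forall m m', dual_cone pcone m -> dual_cone pcone m' ->
    pval (m + m') = pval m * pval m';
  pval_perp : forall m, pval m <> 0 <-> perp pcone m }.

HB.instance Definition _ := gen_eqMixin perm_point.
HB.instance Definition _ := gen_choiceMixin perm_point.

Lemma perm_point_eq (x y : perm_point) :
  pcone x = pcone y -> pval x = pval y -> x = y.
Proof.
case: x y => [c v p1 p2 p3 p4] [c' v' q1 q2 q3 q4] /= ec ev; subst c' v'.
by congr PermPoint; exact: Prop_irrelevance.
Qed.

Definition chart (sigma : set 'rV[R]_n) : set perm_point :=
  [set x | pcone x `<=` sigma].

(* The list of the (c_i, m_i) stands for the Laurent polynomial
   sum_i c_i chi^(m_i). *)
Definition laurent := seq (k * 'rV[int]_n).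

Definition coord_ring (sigma : set 'rV[R]_n) : set laurent :=
  [set f | forall c, c \in f -> dual_cone sigma c.2].

Definition leval (f : laurent) (x : perm_point) : k :=
  \sum_(c <- f) c.1 * pval x c.2.

Definition lmul (f g : laurent) : laurent :=
  [seq (a.1 * b.1, a.2 + b.2) | a <- f, b <- g].

Definition basic_open (sigma : set 'rV[R]_n) (f : laurent) : set perm_point :=
  chart sigma `&` [set x | leval f x <> 0].

Definition zariski_open (U : set perm_point) : Prop :=
  forall x, U x -> exists sigma f, [/\ braid_fan sigma, coord_ring sigma f,
    basic_open sigma f x & basic_open sigma f `<=` U].

Lemma dualD sigma m m' : @dual_cone R n sigma m -> dual_cone sigma m' -> dual_cone sigma (m + m').
Proof.
move=> [mM mp] [m'M m'p]; split.
  rewrite /latticeM /=; under eq_bigr do rewrite mxE.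
  by rewrite big_split /= mM m'M addr0.
move=> x sx; have -> : pairing (m + m') x = pairing m x + pairing m' x.
  rewrite /pairing -big_split; apply: eq_bigr => i _ /=.
  by rewrite mxE intrD mulrDl.
by rewrite addr_ge0 // ?mp ?m'p.
Qed.

Lemma dual0 sigma : @dual_cone R n sigma 0.
Proof.
split; first by rewrite /latticeM /= big1 // => i _; rewrite mxE.
by move=> x _; rewrite /pairing big1 // => i _; rewrite mxE mul0r.
Qed.

Lemma dual_anti sigma tau : tau `<=` sigma -> @dual_cone R n sigma `<=` dual_cone tau.
Proof. by move=> ts m [mM mp]; split=> // x /ts; exact: mp. Qed.

Lemma coord_ring_anti sigma tau : tau `<=` sigma ->
  coord_ring sigma `<=` coord_ring tau.
Proof. by move=> ts f fs c /fs; exact: dual_anti. Qed.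

Lemma coord_ring_mul sigma f g :
  coord_ring sigma f -> coord_ring sigma g -> coord_ring sigma (lmul f g).
Proof.
move=> fs gs c /allpairsP [[a b] /= [af bg ->]] /=.
by apply: dualD; [exact: fs|exact: gs].
Qed.

Lemma coord_ring_cat sigma f g :
  coord_ring sigma f -> coord_ring sigma g -> coord_ring sigma (f ++ g).
Proof. by move=> fs gs c; rewrite mem_cat => /orP [/fs|/gs]. Qed.

Lemma leval_cat f g x : leval (f ++ g) x = leval f x + leval g x.
Proof. by rewrite /leval big_cat. Qed.

Lemma leval_cst c x : leval [:: (c, 0)] x = c.
Proof. by rewrite /leval big_seq1 pval0 mulr1. Qed.

Lemma coord_ring_cst sigma c : coord_ring sigma [:: (c, 0)].
Proof. by move=> d; rewrite inE => /eqP ->; exact: dual0. Qed.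

Lemma leval_mul sigma f g x : coord_ring sigma f -> coord_ring sigma g ->
  chart sigma x -> leval (lmul f g) x = leval f x * leval g x.
Proof.
move=> fs gs xs; rewrite /leval /lmul big_allpairs_dep /= mulr_suml.
apply: eq_big_seq => a af; rewrite mulr_sumr; apply: eq_big_seq => b bg.
rewrite (pvalD (dual_anti xs (fs _ af)) (dual_anti xs (gs _ bg))).
exact: mulrACA.
Qed.

Lemma zariski_openT : zariski_open setT.
Proof.
move=> x _; exists (pcone x), [:: (1, 0)].
split=> //; [exact: pcone_fan|exact: coord_ring_cst|].
by split=> //=; rewrite leval_cst; apply/eqP; rewrite oner_eq0.
Qed.

Lemma zariski_openI : setI_closed zariski_open.
Proof.
move=> A B oA oB x [/oA [s [f [_ fs [xs fx] sA]]] /oB [t [g [_ gt [xt gx] sB]]]].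
have fx' := coord_ring_anti xs fs; have gx' := coord_ring_anti xt gt.
have xx : chart (pcone x) x by [].
exists (pcone x), (lmul f g); split.
- exact: pcone_fan.
- exact: coord_ring_mul.
- split=> //=; rewrite (leval_mul fx' gx' xx); apply/eqP.
  by rewrite mulf_neq0 //; apply/eqP.
move=> y [yx /=]; rewrite (leval_mul fx' gx' yx) => /eqP.
rewrite mulf_eq0 negb_or => /andP [/eqP fy /eqP gy].
by split; [apply: sA|apply: sB]; split=> //= z /yx; [exact: xs|exact: xt].
Qed.

Lemma zariski_open_bigU (I : Type) (f : I -> set perm_point) :
  (forall i, zariski_open (f i)) -> zariski_open (\bigcup_i f i).
Proof.
move=> fo x [i _ /fo [s [h [? ? ? sf]]]]; exists s, h; split=> // y /sf ?.
by exists i.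
Qed.

HB.instance Definition _ := isOpenTopological.Build perm_point
  zariski_openT zariski_openI zariski_open_bigU.

Lemma perm_openE (U : set perm_point) : open U <-> zariski_open U.
Proof.
split=> [|oU].
  rewrite openE => oU x /oU [V [oV Vx sV]].
  have [s [f [? ? ? sf]]] := oV _ Vx.
  by exists s, f; split=> //; exact: subset_trans sf sV.
by rewrite openE => x Ux; exists U; split.
Qed.

Lemma open_chart sigma : braid_fan sigma -> open (chart sigma).
Proof.
move=> fs; apply/perm_openE => x xs; exists sigma, [:: (1, 0)].
split=> //; [exact: coord_ring_cst| |by move=> y []].
by split=> //=; rewrite leval_cst; apply/eqP; rewrite oner_eq0.
Qed.

Definition perm_reg (U : opens perm_point) (f : U -> k) : Prop :=
  forall x : U, exists (V : opens perm_point) sigma p q,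
    [/\ opens_set V (val x), braid_fan sigma, coord_ring sigma p, coord_ring sigma q &
      forall y : U, opens_set V (val y) -> [/\ chart sigma (val y), leval q (val y) <> 0
        & f y = leval p (val y) / leval q (val y)]].

Definition opensI (X : topologicalType) (U V : opens X) : opens X :=
  Opens (openI (opens_open U) (opens_open V)).

Lemma perm_reg2 (U : opens perm_point) (f g : U -> k) (x : U) :
  perm_reg f -> perm_reg g ->
  exists (V : opens perm_point) sigma p1 q1 p2 q2,
    [/\ opens_set V (val x), braid_fan sigma, coord_ring sigma p1 /\ coord_ring sigma q1,
        coord_ring sigma p2 /\ coord_ring sigma q2 &
      forall y : U, opens_set V (val y) -> [/\ chart sigma (val y),
        leval q1 (val y) <> 0, leval q2 (val y) <> 0,
        f y = leval p1 (val y) / leval q1 (val y) &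
        g y = leval p2 (val y) / leval q2 (val y)]].
Proof.
move=> /(_ x) [V1 [s1 [p1 [q1 [V1x _ ps1 qs1 H1]]]]].
move=> /(_ x) [V2 [s2 [p2 [q2 [V2x _ ps2 qs2 H2]]]]].
have [xs1 _ _] := H1 _ V1x; have [xs2 _ _] := H2 _ V2x.
exists (opensI (Opens (open_chart (pcone_fan (val x)))) (opensI V1 V2)).
exists (pcone (val x)), p1, q1, p2, q2; split.
- by split=> //; split.
- exact: pcone_fan.
- by split; exact: coord_ring_anti xs1 _ _.
- by split; exact: coord_ring_anti xs2 _ _.
move=> y [yx [V1y V2y]].
by have [_ ? ?] := H1 _ V1y; have [_ ? ?] := H2 _ V2y; split.
Qed.

Lemma perm_reg_cst (U : opens perm_point) (c : k) :
  perm_reg (fun _ : opens_set U => c).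
Proof.
move=> x; exists (Opens (open_chart (pcone_fan (val x)))), (pcone (val x)).
exists [:: (c, 0)], [:: (1, 0)]; split=> //; first exact: pcone_fan.
- exact: coord_ring_cst.
- exact: coord_ring_cst.
move=> y yx; rewrite !leval_cst divr1; split=> //.
by apply/eqP; rewrite oner_eq0.
Qed.

Lemma perm_reg_sub (U : opens perm_point) (f g : U -> k) :
  perm_reg f -> perm_reg g -> perm_reg (f - g).
Proof.
move=> rf rg x.
have [V [s [p1 [q1 [p2 [q2 [Vx fs [ps1 qs1] [ps2 qs2] H]]]]]]] :=
  perm_reg2 x rf rg.
have cs := @coord_ring_cst s (-1).
exists V, s, (lmul p1 q2 ++ lmul [:: (-1, 0)] (lmul p2 q1)), (lmul q1 q2).
split=> //.
- by apply: coord_ring_cat; do !apply: coord_ring_mul.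
- exact: coord_ring_mul.
move=> y Vy; have [ys /eqP q1y /eqP q2y fy gy] := H _ Vy.
have pq := coord_ring_mul ps2 qs1.
rewrite leval_cat (leval_mul cs pq ys) leval_cst.
rewrite (leval_mul ps1 qs2 ys) (leval_mul ps2 qs1 ys) (leval_mul qs1 qs2 ys).
split=> //; first by apply/eqP; rewrite mulf_neq0.
have -> : (f - g) y = f y - g y by [].
by rewrite fy gy -mulNr addf_div // mulN1r mulNr.
Qed.

Lemma perm_reg_mul (U : opens perm_point) (f g : U -> k) :
  perm_reg f -> perm_reg g -> perm_reg (f * g).
Proof.
move=> rf rg x.
have [V [s [p1 [q1 [p2 [q2 [Vx fs [ps1 qs1] [ps2 qs2] H]]]]]]] :=
  perm_reg2 x rf rg.
exists V, s, (lmul p1 p2), (lmul q1 q2); split=> //; try exact: coord_ring_mul.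
move=> y Vy; have [ys /eqP q1y /eqP q2y fy gy] := H _ Vy.
rewrite (leval_mul ps1 ps2 ys) (leval_mul qs1 qs2 ys).
split=> //; first by apply/eqP; rewrite mulf_neq0.
have -> : (f * g) y = f y * g y by [].
by rewrite fy gy mulf_div.
Qed.

Lemma perm_reg_res (U V : opens perm_point) (s : U `<=` V) (f : V -> k) :
  perm_reg f -> perm_reg (f \o incl s).
Proof.
move=> rf x; have [W [t [p [q [Wx ? ? ? H]]]]] := rf (incl s x).
by exists W, t, p, q; split=> // y Wy; exact: (H (incl s y)).
Qed.

Lemma perm_reg_local (U : opens perm_point) (f : U -> k) :
  (forall x : U, exists (V : opens perm_point) (s : V `<=` U),
      opens_set V (val x) /\ perm_reg (f \o incl s)) ->
  perm_reg f.
Proof.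
move=> H x; have [V [s [Vx rf]]] := H x.
pose x' : V := exist _ (val x) (mem_set Vx).
have [W [t [p [q [Wx ? ? ? HW]]]]] := rf x'.
exists (opensI V W), t, p, q; split=> // y [Vy Wy].
have [? ? fy] := HW (exist _ (val y) (mem_set Vy)) Wy.
by split=> //; rewrite -fy /=; congr f; apply: val_inj.
Qed.

Definition Perm : fspace k :=
  FSpace perm_reg_cst perm_reg_sub perm_reg_mul perm_reg_res perm_reg_local.

End Perm.

(* The automorphism of Perm_n given by g sends U_sigma to U_(g sigma) and pulls
   chi^m back to chi^(g^-1 m). *)
Section PermAction.
Variables (R : realType) (k : fieldType) (n : nat).
Local Notation X := (Perm R k n).
Implicit Types g : 'S_2 * 'S_n.

Lemma gactK (A : pzRingType) g : cancel (@gact A n g) (gact g^-1%g).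
Proof.
move=> x; apply/rowP => i; rewrite !mxE /= odd_permV invgK mulrA -signr_addb.
by rewrite addbb mul1r permK.
Qed.

Lemma gactVK (A : pzRingType) g : cancel (gact g^-1%g) (@gact A n g).
Proof. by move=> x; rewrite -{1}[g]invgK gactK. Qed.

Lemma gact0 (A : pzRingType) g : gact g 0 = 0 :> 'rV[A]_n.
Proof. by apply/rowP => i; rewrite !mxE mulr0. Qed.

Lemma gactD (A : pzRingType) g (x y : 'rV[A]_n) :
  gact g (x + y) = gact g x + gact g y.
Proof. by apply/rowP => i; rewrite !mxE mulrDr. Qed.

Lemma pairing_gact g m (x : 'rV[R]_n) :
  pairing (gact g m) (gact g x) = pairing m x.
Proof.
rewrite /pairing (reindex_inj (@perm_inj _ g.2)) /=; apply: eq_bigr => i _.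
rewrite !mxE permK intrM rmorph_sign mulrACA -signr_addb addbb mul1r //.
Qed.

Lemma latticeM_gact g (m : 'rV[int]_n) : latticeM m -> latticeM (gact g m).
Proof.
rewrite /latticeM /= => mM; under eq_bigr do rewrite mxE.
rewrite -mulr_sumr (reindex_inj (@perm_inj _ g.2)) /=.
by under eq_bigr do rewrite permK; rewrite mM mulr0.
Qed.

Lemma dual_gact g (s : set 'rV[R]_n) m : dual_cone s m -> dual_cone (gact g @` s) (gact g m).
Proof.
move=> [mM mp]; split; first exact: latticeM_gact.
by move=> _ [x sx <-]; rewrite pairing_gact; exact: mp.
Qed.

Lemma perp_gact g (s : set 'rV[R]_n) m : perp s m -> perp (gact g @` s) (gact g m).
Proof.
move=> [mM mp]; split; first exact: latticeM_gact.
by move=> _ [x sx <-]; rewrite pairing_gact; exact: mp.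
Qed.

Lemma gact_imageK g (s : set 'rV[R]_n) : gact g^-1%g @` (gact g @` s) = s.
Proof.
apply/seteqP; split=> [_ [_ [x sx <-] <-]|x sx]; first by rewrite gactK.
by exists (gact g x); [exists x|rewrite gactK].
Qed.

Definition wact g (w : 'S_n) : 'S_n :=
  ((if odd_perm g.1 then perm (@rev_ord_inj n) else 1) * w * g.2)%g.

Lemma lew_wact g w i j : lew (wact g w) (g.2 i) (g.2 j) =
  if odd_perm g.1 then lew w j i else lew w i j.
Proof.
rewrite /lew /wact /= !invMg !permM !permK; case: odd_perm; last first.
  by rewrite invg1 !perm1.
have rK a : ((perm (@rev_ord_inj n))^-1 a)%g = rev_ord a.
  by apply: (@perm_inj _ (perm (@rev_ord_inj n))); rewrite permKV permE rev_ordK.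
rewrite !rK /=; move: (w^-1%g i) (w^-1%g j) => a b.
have := ltn_ord a; have := ltn_ord b; lia.
Qed.

Lemma chamber_gactP g w x : chamber R (wact g w) (gact g x) <-> chamber R w x.
Proof.
split=> H i j.
  move=> ij; have [go|ge] := boolP (odd_perm g.1).
    have := H (g.2 j) (g.2 i); rewrite lew_wact go => /(_ ij).
    by rewrite !mxE !permK go !mulN1r lerN2.
  have := H (g.2 i) (g.2 j); rewrite lew_wact (negPf ge) => /(_ ij).
  by rewrite !mxE !permK (negPf ge) !mul1r.
rewrite -[i](permKV g.2) -[j](permKV g.2) lew_wact !mxE !permK.
by case: odd_perm => /H; rewrite ?mulN1r ?lerN2 ?mul1r.
Qed.

Lemma chamber_gact g w : gact g @` (chamber R w) = chamber R (wact g w).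
Proof.
apply/seteqP; split=> [_ [x wx <-]|x wx]; first exact/chamber_gactP.
by exists (gact g^-1%g x); [apply/(chamber_gactP g)|]; rewrite gactVK.
Qed.

Lemma braid_fan_gact g s : @braid_fan R n s -> braid_fan (gact g @` s).
Proof.
move=> [w [m [dm ->]]]; exists (wact g w), (gact g m); split.
  by rewrite -chamber_gact; exact: dual_gact.
apply/seteqP; split=> [_ [x [wx mx] <-]|x [wx mx]].
  by split; [exact/chamber_gactP|rewrite /= pairing_gact].
exists (gact g^-1%g x); last by rewrite gactVK.
split; first by apply/(chamber_gactP g); rewrite gactVK.
by rewrite /= -(pairing_gact g) gactVK.
Qed.

Section ActOnPoint.
Variables (g : 'S_2 * 'S_n) (x : X).
Let c := gact g @` (pcone x).
Let v m := pval x (gact g^-1%g m).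

Let dualc m : dual_cone c m -> dual_cone (pcone x) (gact g^-1%g m).
Proof. by move=> /(dual_gact g^-1%g); rewrite gact_imageK. Qed.

Let v0 : v 0 = 1.
Proof. by rewrite /v gact0 pval0. Qed.

Let vD m m' : dual_cone c m -> dual_cone c m' -> v (m + m') = v m * v m'.
Proof. by move=> /dualc dm /dualc dm'; rewrite /v gactD pvalD. Qed.

Let v_perp m : v m <> 0 <-> perp c m.
Proof.
rewrite /v; split=> [/pval_perp /(perp_gact g)|pm]; first by rewrite gactVK.
by apply/pval_perp; have := perp_gact g^-1%g pm; rewrite gact_imageK.
Qed.

Definition act_point : X :=
  PermPoint (braid_fan_gact g (pcone_fan x)) v0 vD v_perp.
End ActOnPoint.

Lemma act_pointK g : cancel (act_point g) (act_point g^-1%g).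
Proof.
move=> x; apply: perm_point_eq => /=; first exact: gact_imageK.
by apply/funext => m; rewrite invgK gactK.
Qed.

Lemma act_pointVK g : cancel (act_point g^-1%g) (act_point g).
Proof. by move=> x; rewrite -{1}[g]invgK act_pointK. Qed.

Definition lact g (f : laurent k n) : laurent k n :=
  [seq (c.1, gact g^-1%g c.2) | c <- f].

Lemma coord_ring_act g s f :
  coord_ring s f -> coord_ring (gact g^-1%g @` s : set 'rV[R]_n) (lact g f).
Proof. by move=> fs _ /mapP [c cf ->]; apply: dual_gact; exact: fs. Qed.

Lemma leval_act g f x : leval (lact g f) x = leval f (act_point g x).
Proof. by rewrite /leval /lact big_map. Qed.

Lemma chart_act g s x : chart (gact g^-1%g @` s) x <-> chart s (act_point g x).
Proof.
split=> [H _ [y /H [z sz <-] <-]|H y xy]; first by rewrite gactVK.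
by exists (gact g y); [apply: H; exists y|rewrite gactK].
Qed.

Lemma act_cont g (U : set X) : open U -> open (act_point g @^-1` U).
Proof.
move=> /perm_openE oU; apply/perm_openE => x.
move=> /oU [s [f [fs sf [xs fx] sU]]].
exists (gact g^-1%g @` s), (lact g f); split.
- exact: braid_fan_gact.
- exact: coord_ring_act.
- by split; [exact/chart_act|rewrite /= leval_act].
move=> y [ys fy]; apply: sU; split; first exact/chart_act.
by move: fy; rewrite /= leval_act.
Qed.

Lemma act_reg g (U : opens X) (f : U -> k) : reg f ->
  reg (U := opens_preim (@act_cont g) U) (f \o @preimage_map _ _ (act_point g) U).
Proof.
move=> rf x; have [V [s [p [q [Vx fs ps qs H]]]]] := rf (preimage_map x).
exists (opens_preim (@act_cont g) V), (gact g^-1%g @` s), (lact g p), (lact g q).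
split=> //; try exact: coord_ring_act; first exact: braid_fan_gact.
move=> y Vy; have [ys qy fy] := H (preimage_map y) Vy.
by rewrite !leval_act; split=> //; exact/chart_act.
Qed.

Definition Perm_action g : automorphism X :=
  Automorphism (act_pointK g) (act_pointVK g) (@act_reg g) (@act_reg g^-1%g).

End PermAction.

Section Divisors.
Variables (R : realType) (k : fieldType) (n : nat).
Local Notation X := (Perm R k n).
Implicit Types U V W : opens X.

Definition torus : set X := [set x | pcone x = zero_cone R n].

(* The closure of the torus orbit attached to the ray of e_S *)
Definition ray_divisor (S : {set 'I_n}) : set X :=
  closure [set x : X | pcone x = ray R S].

(* h generates on V the ideal sheaf of functions vanishing on Z. *)
Definition local_equation V (Z : set X) (h : OX V) : Prop :=
  forall W (s : W `<=` V) (f : OX W),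
    (forall x : W, Z (val x) -> f x = 0) <->
    exists f' : OX W, f = OX_res s h * f'.

Definition torus_fun U : Type := (U `&` torus) -> k.
HB.instance Definition _ U := GRing.Zmodule.copy (torus_fun U) ((U `&` torus) -> k).

Lemma torus_subl U : U `&` torus `<=` U. Proof. by move=> x []. Qed.

Lemma torus_sub U V : U `<=` V -> U `&` torus `<=` V `&` torus.
Proof. by move=> s x [Ux Tx]; split=> //; exact: s. Qed.

Definition torus_scale U (a : OX U) (f : torus_fun U) : torus_fun U :=
  fun x => a (incl (@torus_subl U) x) * f x.

Lemma torus_scaleA U a b f :
  @torus_scale U a (torus_scale b f) = torus_scale (a * b) f.
Proof. by apply/funext => x; rewrite /torus_scale mulrA. Qed.

Lemma torus_scale1 U : left_id 1 (@torus_scale U).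
Proof. by move=> f; apply/funext => x; rewrite /torus_scale mul1r. Qed.

Lemma torus_scaleDr U : right_distributive (@torus_scale U) +%R.
Proof. by move=> a f g; apply/funext => x; rewrite /torus_scale -mulrDr. Qed.

Lemma torus_scaleDl U f : {morph (@torus_scale U)^~ f : a b / a + b}.
Proof. by move=> a b; apply/funext => x; rewrite /torus_scale -mulrDl. Qed.

HB.instance Definition _ U := GRing.Zmodule_isLmodule.Build (OX U) (torus_fun U)
  (@torus_scaleA U) (@torus_scale1 U) (@torus_scaleDr U) (@torus_scaleDl U).

Variable a : {set 'I_n} -> int.

(* O(D) for D = sum_S a_S D_S: since D is supported off the torus, its sections
   are functions on the torus; phi belongs to O(D) near x when phi times the
   local equation prod_S h_S^(a_S) of D is regular near x.  Local equations h_S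
   of the D_S exist near every point because Perm_n is smooth, and they are
   unique up to units. *)
Definition div_section U : set (torus_fun U) :=
  [set phi | forall (x : U) V (s : V `<=` U) (h : {set 'I_n} -> OX V),
     opens_set V (val x) ->
     (forall S, proper_subset S -> local_equation (ray_divisor S) (h S)) ->
     exists W (t : W `<=` V) (psi : OX W), opens_set W (val x) /\
       forall y : (W `&` torus),
         phi (incl (torus_sub (subset_trans t s)) y) *
           \prod_(S | proper_subset S)
              (h S (incl (subset_trans (@torus_subl W) t) y)) ^ a S =
         psi (incl (@torus_subl W) y)].

Definition div_pred U : {pred torus_fun U} := [pred f | f \in @div_section U].

Lemma div_pred_submod U : submod_closed (@div_pred U).
Proof.
split=> [|b f g]; rewrite !inE.
  move=> x V s h Vx _; exists V, (subset_refl (A := V)), 0; split=> // y.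
  by rewrite mul0r.
move=> Hf Hg x V s h Vx hh.
have [W1 [t1 [p1 [W1x H1]]]] := Hf x V s h Vx hh.
have [W2 [t2 [p2 [W2x H2]]]] := Hg x V s h Vx hh.
pose W := opensI W1 W2.
have s1 : W `<=` W1 by move=> y [].
have s2 : W `<=` W2 by move=> y [].
have t : W `<=` V by exact: subset_trans s1 t1.
exists W, t, (OX_res (subset_trans t s) b * OX_res s1 p1 + OX_res s2 p2).
split=> // y.
have E1 := H1 (incl (torus_sub s1) y); have E2 := H2 (incl (torus_sub s2) y).
have -> : OX_fun (OX_res (subset_trans t s) b * OX_res s1 p1 + OX_res s2 p2)
    (incl (@torus_subl W) y) =
  b (incl (subset_trans t s) (incl (@torus_subl W) y)) *
  p1 (incl s1 (incl (@torus_subl W) y)) + p2 (incl s2 (incl (@torus_subl W) y)).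
  by [].
rewrite (_ : incl s1 _ = incl (@torus_subl W1) (incl (torus_sub s1) y));
  last exact: val_inj.
rewrite (_ : incl s2 _ = incl (@torus_subl W2) (incl (torus_sub s2) y));
  last exact: val_inj.
rewrite -E1 -E2.
have eT W' (t' : W' `<=` V) (y' : W' `&` torus) : val y' = val y ->
    incl (torus_sub (subset_trans t' s)) y' =
    incl (torus_sub (subset_trans t s)) y by move=> e; exact: val_inj.
have eV W' (t' : W' `<=` V) (y' : W' `&` torus) : val y' = val y ->
    incl (subset_trans (@torus_subl W') t') y' =
    incl (subset_trans (@torus_subl W) t) y by move=> e; exact: val_inj.
rewrite (eT W1) // (eT W2) //.
under [X in b _ * (_ * X)]eq_bigr do rewrite (eV W1) //.
under [X in _ + _ * X]eq_bigr do rewrite (eV W2) //.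
rewrite mulrA -mulrDl; congr (_ * _).
have -> : (b *: f + g) (incl (torus_sub (subset_trans t s)) y) =
  b (incl (@torus_subl U) (incl (torus_sub (subset_trans t s)) y)) *
  f (incl (torus_sub (subset_trans t s)) y) +
  g (incl (torus_sub (subset_trans t s)) y) by [].
by congr (b _ * _ + _); exact: val_inj.
Qed.

HB.instance Definition _ U := GRing.isSubmodClosed.Build (OX U) (torus_fun U)
  (@div_pred U) (@div_pred_submod U).

Record div_sec U := DivSec { div_fun :> torus_fun U; div_mem : div_fun \in @div_pred U }.

HB.instance Definition _ U := [isSub for @div_fun U].
HB.instance Definition _ U := [Choice of div_sec U by <:].
HB.instance Definition _ U := GRing.SubChoice_isSubLmodule.Build
  (OX U) (torus_fun U) (@div_pred U) (div_sec U) (GRing.submodClosedP _).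

Lemma local_equation_res U V (s : U `<=` V) (Z : set X) (h : OX V) :
  local_equation Z h -> local_equation Z (OX_res s h).
Proof.
move=> hh W t f; rewrite (hh W (subset_trans t s) f).
have e : OX_res t (OX_res s h) = OX_res (subset_trans t s) h.
  by apply: val_inj; apply/funext => x; congr (OX_fun h _); exact: val_inj.
by rewrite e.
Qed.

Lemma div_res_subproof U V (s : U `<=` V) (f : div_sec V) :
  (div_fun f \o incl (torus_sub s) : torus_fun U) \in @div_pred U.
Proof.
rewrite inE => x W t h Wx hh; have := div_mem f; rewrite inE.
move=> /(_ (incl s x) W (subset_trans t s) h Wx hh) [W' [t' [psi [W'x H]]]].
exists W', t', psi; split=> // y; rewrite -H /=; congr (div_fun f _ * _).
exact: val_inj.
Qed.

Definition div_res U V (s : U `<=` V) (f : div_sec V) : div_sec U :=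
  DivSec (div_res_subproof s f).

Lemma div_res_add U V (s : U `<=` V) (f g : div_sec V) :
  div_res s (f + g) = div_res s f + div_res s g.
Proof. exact: val_inj. Qed.

Lemma div_res_scale U V (s : U `<=` V) (b : OX V) (f : div_sec V) :
  div_res s (b *: f) = OX_res s b *: div_res s f.
Proof.
apply: val_inj; apply/funext => x.
by congr (OX_fun b _ * _); exact: val_inj.
Qed.

Lemma div_res_id U (s : U `<=` U) (f : div_sec U) : div_res s f = f.
Proof.
by apply: val_inj; apply/funext => x; congr (div_fun f _); exact: val_inj.
Qed.

Lemma div_res_comp U V W (s : U `<=` V) (t : V `<=` W) (st : U `<=` W)
  (f : div_sec W) : div_res s (div_res t f) = div_res st f.
Proof.
by apply: val_inj; apply/funext => x; congr (div_fun f _); exact: val_inj.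
Qed.

Lemma div_sep U (I : Type) (C : I -> opens X) (s : forall i, C i `<=` U) :
  U `<=` \bigcup_i C i -> forall f g : div_sec U,
  (forall i, div_res (s i) f = div_res (s i) g) -> f = g.
Proof.
move=> cov f g fg; apply: val_inj; apply/funext => x.
have [Ux Tx] := set_mem (valP x); have [i _ Cx] := cov _ Ux.
pose x' : (C i `&` torus) := exist _ (val x) (mem_set (conj Cx Tx)).
have -> : x = incl (torus_sub (s i)) x' by exact: val_inj.
exact: (congr1 (fun h : div_sec (C i) => div_fun h x') (fg i)).
Qed.

Lemma div_glue U (I : Type) (C : I -> opens X) (s : forall i, C i `<=` U) :
  U `<=` \bigcup_i C i -> forall f : (forall i, div_sec (C i)),
  (forall i j W (si : W `<=` C i) (sj : W `<=` C j),
      div_res si (f i) = div_res sj (f j)) ->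
  exists g : div_sec U, forall i, div_res (s i) g = f i.
Proof.
move=> cov f ff.
have pick (x : U `&` torus) : {i | opens_set (C i) (val x)}.
  by apply: cid; have [Ux _] := set_mem (valP x); have [i _] := cov _ Ux; exists i.
have inT (x : U `&` torus) : torus (val x) by have [] := set_mem (valP x).
pose g : torus_fun U := fun x =>
  div_fun (f (projT1 (pick x))) (exist _ (val x) (mem_set (conj (projT2 (pick x)) (inT x)))).
have gE i (y : C i `&` torus) (x : U `&` torus) : val y = val x -> g x = div_fun (f i) y.
  move=> yx; rewrite /g; set j := projT1 _; set y' := exist _ _ _.
  pose W := opensI (C i) (C j).
  have si : W `<=` C i by move=> z [].
  have sj : W `<=` C j by move=> z [].
  have Wy : (W `&` torus) (val y).
    have [Cy Ty] := set_mem (valP y); split=> //; split=> //.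
    by rewrite yx; exact: (projT2 (pick x)).
  pose w : (W `&` torus) := exist _ (val y) (mem_set Wy).
  have := congr1 (fun h : div_sec W => div_fun h w) (ff i j W si sj).
  rewrite /= (_ : incl _ w = y); last exact: val_inj.
  rewrite (_ : incl _ w = y') => [->//|].
  exact: val_inj.
have gP : g \in @div_pred U.
  rewrite inE => x V t h Vx hh.
  have [i _ Cx] := cov _ (set_mem (valP x)).
  pose x' : C i := exist _ (val x) (mem_set Cx).
  pose W := opensI V (C i).
  have sV : W `<=` V by move=> z [].
  have sC : W `<=` C i by move=> z [].
  have Wx : opens_set W (val x) by split.
  have := div_mem (f i); rewrite inE.
  move=> /(_ x' W sC (fun S => OX_res sV (h S)) Wx) [|W' [t' [psi [W'x H]]]].
    by move=> S pS; exact/local_equation_res/hh.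
  exists W', (subset_trans t' sV), psi; split=> // y; rewrite -H.
  congr (_ * _); first exact: gE.
  apply: eq_bigr => S _; congr (_ ^ _).
  by rewrite /=; congr (OX_fun (h S) _); exact: val_inj.
exists (DivSec gP) => i; apply: val_inj; apply/funext => y /=.
exact: gE.
Qed.

Definition div_sheaf : modsheaf X :=
  ModSheaf div_res_add div_res_scale div_res_id div_res_comp div_sep div_glue.

End Divisors.

Section Polytopes.
Variables (R : realType) (n : nat).

Definition translate_in_M (P P' : set 'rV[R]_n) : Prop :=
  (exists t : 'rV[int]_n, P' = [set x + map_mx intr t | x in P]) /\
  P' `<=` [set x | \sum_i x 0 i = 0].

(* max_(x in P) sum_(i in S) x_i, an integer when P is a lattice polytope *)
Definition support_coef (P : set 'rV[R]_n) (S : {set 'I_n}) : int :=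
  Num.floor (sup [set \sum_(i in S) x 0 i | x in P]).

(* The convex hull of the points e_B for B in Omega *)
Definition base_polytope (Omega : {set {set 'I_n}}) : set 'rV[R]_n :=
  [set x | exists c : {set 'I_n} -> R,
     [/\ forall B, B \in Omega -> 0 <= c B, \sum_(B in Omega) c B = 1 &
         x = \sum_(B in Omega) c B *: indic R B]].

End Polytopes.

Definition polytope_line_bundle (R : realType) (k : fieldType) (n : nat)
  (P' : set 'rV[R]_n) : modsheaf (Perm R k n) :=
  @div_sheaf R k n (support_coef P').

(* Matroids on 'I_n, given by their sets of bases *)
Section Schubert.
Variable n : nat.

Definition gale (w : 'S_n) (S T : {set 'I_n}) : bool :=
  all2 (lew w) (sort (lew w) (enum S)) (sort (lew w) (enum T)).

Definition schubert (w : 'S_n) (S : {set 'I_n}) : {set {set 'I_n}} :=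
  [set T : {set 'I_n} | (#|T| == #|S|) && gale w S T]%SET.

Definition is_schubert (Omega : {set {set 'I_n}}) : bool :=
  [exists w, exists S, Omega == schubert w S].

Definition loopless (Omega : {set {set 'I_n}}) : bool :=
  [forall i, exists B, (B \in Omega) && (i \in B)].

Definition loopless_schubert : Type :=
  {Omega : {set {set 'I_n}} | is_schubert Omega && loopless Omega}.

End Schubert.

(* Main.v *)
(* Write g.P for the image of a polytope P under g in S_2 x S_n.  The direct image of
   O(sum a_S D_S) under g is O(sum a_S D_(gS)), where g e_S = e_(gS) in N, so L_P is sent
   to L_(g.P).  For the base polytope of a matroid, the odd element of S_2 acts, up to a
   translation, by matroid duality, and the dual of a Schubert matroid is the Schubert
   matroid of the complement for the reversed order.  It may have loops; turning all its
   loops into coloops translates the base polytope and yields a loopless Schubert matroid.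

   Translating P by m in M replaces O(D) by O(D + div chi^m) up to sign, and
   multiplication by chi^m is an isomorphism between the two.  Since O(D) is defined with
   arbitrary local equations h_S of the divisors D_S, this requires that h_S agrees up to
   a unit with the character dual to e_S in a chamber containing the cone of the point. *)
Require Import Defs.
From HB Require Import structures.
From mathcomp Require Import all_boot all_order all_algebra all_fingroup.
From mathcomp Require Import all_classical all_reals topology_structure.
From mathcomp Require Import zify lra.

Set Implicit Arguments.
Unset Strict Implicit.
Unset Printing Implicit Defensive.

(* [Defs] comes last because [perm] also exports names [Perm] and [pval]. *)
Import Order.TTheory GRing.Theory Num.Theory Defs.

(** * The braid fan: dual bases of the chambers, rays and faces *)

Section Fan.
Local Open Scope classical_set_scope.
Local Open Scope ring_scope.
Variables (R : realType) (n : nat).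
Implicit Types (m : 'rV[int]_n) (x y : 'rV[R]_n) (S : {set 'I_n}) (w : 'S_n).

(** The obstacle is that a local equation [h] of [D_S] is known only through the ideal it generates.
    Near a point [x], whose cone is a face of the chamber of [w], it is compared with the character
    [chi] of exponent [mu w S]. If [chi] does not vanish at [x], the divisor misses a neighbourhood
    of [x] and [h] is a unit there. Otherwise [chi] vanishes on [D_S], hence is a multiple of [h];
    conversely [h] vanishes on the orbit of the ray of [S], and divisibility by [chi] has to be read
    off from a fraction of Laurent polynomials. The terms of the numerator that [chi] does not
    divide are those whose exponent pairs to 0 with [e_S], that is, those that survive on the orbit.
    Their sum must vanish: the field is infinite, and Laurent polynomials that are not formally zero
    take nonzero values along a suitable one-parameter subgroup.

    On the combinatorial side, the Gale order is expressed by the number of elements in initial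
    segments, a form in which complements and displaced loops are a matter of counting. *)

Definition msum m S : int := \sum_(i in S) m 0 i.

Lemma pairingDl m m' x : pairing (m + m') x = pairing m x + pairing m' x.
Proof.
by rewrite /pairing -big_split; apply: eq_bigr => i _; rewrite mxE intrD mulrDl.
Qed.

Lemma pairing0l x : pairing 0 x = 0.
Proof. by rewrite /pairing big1 // => i _; rewrite mxE mul0r. Qed.

Lemma pairingZl c m x : pairing (c *: m) x = c%:~R * pairing m x.
Proof.
by rewrite /pairing mulr_sumr; apply: eq_bigr => i _; rewrite mxE intrM mulrA.
Qed.

Lemma pairingBl m m' x : pairing (m - m') x = pairing m x - pairing m' x.
Proof. by rewrite pairingDl -scaleN1r pairingZl mulN1r. Qed.

Lemma pairing_suml (I : finType) (P : pred I) (F : I -> 'rV[int]_n) x :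
  pairing (\sum_(i | P i) F i) x = \sum_(i | P i) pairing (F i) x.
Proof.
exact: (big_morph (fun m => pairing m x) (fun m m' => pairingDl m m' x) (pairing0l x)).
Qed.

Lemma pairing_delta i x : pairing (delta_mx 0 i) x = x 0 i.
Proof.
rewrite /pairing (bigD1 i) //= mxE !eqxx mul1r big1 ?addr0 // => j ji.
by rewrite mxE (negPf ji) andbF mul0r.
Qed.

Lemma pairing_ray m S (c d : R) : latticeM m ->
  pairing m (c *: indic R S + const_mx d) = c * (msum m S)%:~R.
Proof.
move=> mM; transitivity (\sum_i (c * ((m 0 i)%:~R * (i \in S)%:R) + d * (m 0 i)%:~R)).
  by apply: eq_bigr => i _; rewrite !mxE mulrDr mulrCA [X in _ + X]mulrC.
rewrite big_split /= -!mulr_sumr -[X in _ + d * X](rmorph_sum intr) mM mulr0 addr0.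
congr (c * _); rewrite /msum rmorph_sum [RHS]big_mkcond; apply: eq_bigr => i _.
by case: ifP; rewrite ?mulr1 ?mulr0.
Qed.

Lemma pairing_indic m S : latticeM m -> pairing m (indic R S) = (msum m S)%:~R.
Proof.
move=> mM; rewrite -[RHS]mul1r -(pairing_ray _ 1 0 mM) scale1r.
by congr pairing; apply/rowP => i; rewrite !mxE addr0.
Qed.

Lemma ray_indic S : ray R S (indic R S).
Proof.
by exists 1, 0; split=> //; apply/rowP => i; rewrite !mxE mul1r addr0.
Qed.

Lemma perp_ray m S : latticeM m -> perp (ray R S) m <-> msum m S = 0.
Proof.
move=> mM; split=> [[_ /(_ _ (ray_indic S))]|m0].
  by rewrite pairing_indic // => /eqP; rewrite intr_eq0 => /eqP.
by split=> // _ [c [d [_ ->]]]; rewrite pairing_ray // m0 mulr0.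
Qed.

Lemma dual_ray m S : dual_cone (ray R S) m -> 0 <= msum m S.
Proof. by case=> mM /(_ _ (ray_indic S)); rewrite pairing_indic // ler0z. Qed.

Lemma perp_zero_cone m : latticeM m -> perp (zero_cone R n) m.
Proof.
move=> mM; split=> // _ [d _ <-].
have -> : const_mx d = (0 : R) *: indic R finset.set0 + const_mx d :> 'rV_n.
  by apply/rowP => i; rewrite !mxE mul0r add0r.
by rewrite pairing_ray // mul0r.
Qed.

Lemma latticeM0 : @latticeM n 0.
Proof. by rewrite /latticeM /= big1 // => i _; rewrite mxE. Qed.

Lemma latticeMN m : latticeM m -> latticeM (- m).
Proof.
rewrite /latticeM /= => mM; under eq_bigr do rewrite mxE.
by rewrite sumrN mM oppr0.
Qed.

Lemma latticeMB m m' : latticeM m -> latticeM m' -> latticeM (m - m').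
Proof.
rewrite /latticeM /= => mM mM'; under eq_bigr do rewrite !mxE.
by rewrite sumrB mM mM' subr0.
Qed.

Lemma delta_sum i : \sum_j (delta_mx 0 i : 'rV[int]_n) 0 j = 1.
Proof.
by rewrite (bigD1 i) //= mxE !eqxx big1 ?addr0 // => j ji; rewrite mxE (negPf ji) andbF.
Qed.

Lemma latticeM_delta i j : latticeM (delta_mx 0 i - delta_mx 0 j : 'rV[int]_n).
Proof.
transitivity (\sum_l ((delta_mx 0 i : 'rV[int]_n) 0 l - (delta_mx 0 j : 'rV[int]_n) 0 l)).
  by apply: eq_bigr => l _; rewrite !mxE.
by rewrite sumrB !delta_sum subrr.
Qed.

Lemma msum_delta i S : msum (delta_mx 0 i) S = (i \in S)%:R.
Proof.
rewrite /msum big_mkcond /= (bigD1 i) //= mxE !eqxx big1 ?addr0 => [|j ji].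
  by case: (i \in S).
by rewrite mxE (negPf ji) andbF; case: ifP.
Qed.

Lemma msumD m m' S : msum (m + m') S = msum m S + msum m' S.
Proof. by rewrite /msum -big_split; apply: eq_bigr => i _; rewrite mxE. Qed.

Lemma msumN m S : msum (- m) S = - msum m S.
Proof. by rewrite /msum -sumrN; apply: eq_bigr => i _; rewrite mxE. Qed.

Definition initial w S : bool :=
  [forall i, forall j, lew w i j ==> (j \in S) ==> (i \in S)].

Definition segment w (l : nat) : {set 'I_n} := [set i | ((w^-1)%g i < l)%N]%SET.

Lemma initialP w S :
  reflect (forall i j, lew w i j -> j \in S -> i \in S) (initial w S).
Proof.
apply: (iffP forallP) => [H i j ij jS|H i].
  by have /forallP/(_ j) := H i; rewrite ij jS.
by apply/forallP => j; apply/implyP => ij; apply/implyP; exact: H.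
Qed.

Lemma card_segment w l : (l <= n)%N -> #|segment w l| = l.
Proof.
move=> ln; have -> : segment w l = w @: [set i : 'I_n | (i < l)%N]%SET.
  apply/setP => i; rewrite inE; apply/idP/imsetP => [il|[j]].
    by exists ((w^-1)%g i); rewrite ?inE ?permKV.
  by rewrite inE => jl ->; rewrite permK.
rewrite card_imset; last exact: perm_inj.
by rewrite -sum1dep_card (big_ord_narrow ln) sum1_card card_ord.
Qed.

Lemma initial_segment w l : initial w (segment w l).
Proof. by apply/initialP => i j ij; rewrite !inE; exact: leq_ltn_trans. Qed.

Lemma initialE w S : initial w S -> S = segment w #|S|.
Proof.
move=> /initialP Si; apply/setP => i; rewrite inE; apply/idP/idP => [iS|iS].
  rewrite -[X in (X < _)%N]/(nat_of_ord _) -[X in (X <= _)%N](card_segment w (ltn_ord _)).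
  apply: subset_leq_card; apply/fintype.subsetP => j; rewrite inE ltnS => ji.
  exact: Si iS.
apply: contraTT iS => iS; rewrite -leqNgt.
rewrite -[X in (_ <= X)%N](card_segment w (ltnW (ltn_ord _))).
apply: subset_leq_card; apply/fintype.subsetP => j jS; rewrite inE ltnNge.
by apply: contra iS => ij; exact: Si ij jS.
Qed.

(* The basis of M dual to the rays of the chamber of w, extended by 0 to the S whose ray
   is not in this chamber. *)
Definition mu w S : 'rV[int]_n :=
  if proper_subset S && initial w S then
    \row_i ((((w^-1)%g i).+1 == #|S|)%:R - ((w^-1)%g i == #|S| :> nat)%:R)
  else 0.

(** In the order of [w], [a] is the last element of [S] and [b] the first one outside it, so the
    character is [x_a - x_b], nonnegative on the chamber because coordinates decrease along [w]. *)
Lemma muE w S : proper_subset S -> initial w S ->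
  exists a b, [/\ a \in S, b \notin S, (forall i, i \in S -> lew w i a),
    (forall i, i \notin S -> lew w b i) & mu w S = delta_mx 0 a - delta_mx 0 b].
Proof.
move=> pS iS; have SE := initialE iS.
have [S0 Sn] : (0 < #|S|)%N /\ (#|S| < n)%N.
  move: pS => /andP [? ?]; rewrite card_gt0; split=> //.
  by rewrite -[X in (_ < X)%N]card_ord -cardsT; apply: proper_card; rewrite properT.
have Sn' : (#|S|.-1 < n)%N by lia.
pose a := w (Ordinal Sn'); pose b := w (Ordinal Sn).
have pa : (w^-1)%g a = #|S|.-1 :> nat by rewrite permK.
have pb : (w^-1)%g b = #|S| :> nat by rewrite permK.
exists a, b; split.
- by rewrite SE inE pa; lia.
- by rewrite SE inE pb; lia.
- move=> i; by rewrite SE inE /lew /= pa => ?; rewrite -ltnS prednK.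
- move=> i; by rewrite SE inE -leqNgt /lew /= pb.
rewrite /mu pS iS; apply/rowP => i; rewrite !mxE /=.
have pE (c : 'I_n) : (i == c) = ((w^-1)%g i == (w^-1)%g c :> nat).
  by rewrite (inj_eq val_inj) (inj_eq perm_inj).
rewrite !pE pa pb; congr (_%:R - _%:R); congr nat_of_bool.
by rewrite -{1}(prednK S0) eqSS.
Qed.

Lemma latticeM_mu w S : latticeM (mu w S).
Proof.
rewrite /mu; case: ifP => [/andP [pS iS]|_]; last exact: latticeM0.
have [a [b [_ _ _ _ E]]] := muE pS iS.
by move: E; rewrite /mu pS iS /= => ->; exact: latticeM_delta.
Qed.

Lemma msum_mu w S : proper_subset S -> initial w S -> msum (mu w S) S = 1.
Proof.
move=> pS iS; have [a [b [aS bS _ _ ->]]] := muE pS iS.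
by rewrite msumD msumN !msum_delta aS (negPf bS) subr0.
Qed.

Lemma pairing_mu_ge0 w S x : chamber R w x -> 0 <= pairing (mu w S) x.
Proof.
move=> wx; have [/andP [pS iS]|/negPf N] := boolP (proper_subset S && initial w S).
  have [a [b [aS bS aM bm ->]]] := muE pS iS.
  rewrite pairingBl !pairing_delta subr_ge0; apply: wx.
  move/initialP: iS => iS; rewrite /lew /= leqNgt; apply/negP => ba.
  by move: bS; rewrite (iS b a) // /lew /= ltnW.
by rewrite /mu N pairing0l.
Qed.

(** Summation by parts: [m_i] is the difference of two consecutive partial sums of [m] along [w].
    The empty and the full segment, which span no ray, have partial sum 0, the latter because [m]
    lies in M. *)
Lemma sum_mu w m : latticeM m ->
  m = \sum_(S | proper_subset S) msum m S *: mu w S.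
Proof.
move=> mM; apply/rowP => i; rewrite summxE.
pose E l := \sum_(S | proper_subset S && initial w S) msum m S * (l == #|S|)%:R.
have EE l : (l <= n)%N -> E l = msum m (segment w l).
  move=> ln; have cl := card_segment w ln.
  have [pl|npl] := boolP (proper_subset (segment w l)).
    rewrite /E (bigD1 (segment w l)) /=; last by rewrite pl initial_segment.
    rewrite cl eqxx mulr1 big1 ?addr0 // => S /andP [/andP [_ iS] Sl].
    have [e|_] := eqVneq l #|S|; last by rewrite mulr0.
    by move: Sl; rewrite (initialE iS) -e eqxx.
  rewrite /E big1 => [|S /andP [pS iS]].
    move: npl; rewrite negb_and !negbK => /orP [] /eqP ->.
      by rewrite /msum big_set0.
    by rewrite /msum -[LHS]mM; apply: eq_bigl => j; rewrite inE.
  have [e|_] := eqVneq l #|S|; last by rewrite mulr0.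
  by move: npl; rewrite e -initialE // pS.
transitivity (E ((w^-1)%g i).+1 - E ((w^-1)%g i)).
  rewrite !EE //; last exact: ltnW.
  rewrite /msum (bigD1 i) /=; last by rewrite inE.
  rewrite [X in _ = _ + X - _](eq_bigl (mem (segment w ((w^-1)%g i)))) ?addrK // => j.
  rewrite !inE -(inj_eq (@perm_inj _ (w^-1)%g)) -(inj_eq val_inj) /=; lia.
rewrite /E -sumrB big_mkcondr /=; apply: eq_bigr => S pS.
rewrite mxE /mu pS /=; case: ifP => _; last by rewrite mxE mulr0.
by rewrite mxE mulrBr.
Qed.

Lemma pairing_sum_mu w m x : latticeM m ->
  pairing m x = \sum_(S | proper_subset S) (msum m S)%:~R * pairing (mu w S) x.
Proof.
move=> mM; rewrite {1}(sum_mu w mM) pairing_suml.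
by apply: eq_bigr => S _; rewrite pairingZl.
Qed.

Lemma ray_initial w S : proper_subset S -> ray R S `<=` chamber R w -> initial w S.
Proof.
move=> _ /(_ _ (ray_indic S)) H; apply/initialP => i j ij jS.
by have := H i j ij; rewrite !mxE jS; case: (i \in S) => //; rewrite ler10.
Qed.

Lemma indic_chamber w S : initial w S -> chamber R w (indic R S).
Proof.
move=> /initialP iS i j ij; rewrite !mxE ler_nat.
by case jS: (j \in S) => //; rewrite (iS i j).
Qed.

(** With [f] first and [l] last in the order of [w], the functional [(x_f - x_a) + (x_b - x_l)] is
    nonnegative on the chamber and vanishes exactly when [x] is constant on [S] and on its
    complement. *)
Lemma braid_fan_ray w S : proper_subset S -> initial w S -> braid_fan (ray R S).
Proof.
move=> pS iS; have [a [b [aS bS aM bm _]]] := muE pS iS.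
have n0 : (0 < n)%N by exact: leq_ltn_trans (ltn_ord a).
have n1 : (n.-1 < n)%N by rewrite prednK.
pose f := w (Ordinal n0); pose l := w (Ordinal n1).
have fm i : lew w f i by rewrite /lew /= permK.
have lm i : lew w i l.
  by rewrite /lew /= permK /= -ltnS prednK.
exists w, ((delta_mx 0 f - delta_mx 0 a) - (delta_mx 0 l - delta_mx 0 b)).
have pE x : pairing ((delta_mx 0 f - delta_mx 0 a) - (delta_mx 0 l - delta_mx 0 b)) x =
    (x 0 f - x 0 a) + (x 0 b - x 0 l).
  by rewrite !pairingBl !pairing_delta opprB.
split.
  split; first by apply: latticeMB; exact: latticeM_delta.
  move=> x wx; rewrite pE addr_ge0 // subr_ge0; exact: wx.
move/initialP: iS => iS; apply/seteqP; split=> [_ [c [d [c0 ->]]]|x [wx /=]].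
  split=> [i j ij|]; rewrite /= ?pE !mxE.
    rewrite lerD2r ler_wpM2l // ler_nat.
    by case jS: (j \in S) => //; rewrite (iS i j).
  rewrite aS (negPf bS) (iS f a) //; case lS: (l \in S); last by rewrite !subrr addr0.
  by move: bS; rewrite (iS b l).
rewrite pE => x0; have fa := wx _ _ (fm a); have bl := wx _ _ (lm b).
have ab : lew w a b.
  by rewrite /lew /= leqNgt; apply: contra bS => ba; rewrite (iS b a) // /lew /= ltnW.
exists (x 0 a - x 0 b), (x 0 b); split; first by rewrite subr_ge0; exact: wx.
apply/rowP => i; rewrite !mxE; case: (boolP (i \in S)) => iS'.
  rewrite mulr1 subrK; have := wx _ _ (aM i iS'); have := wx _ _ (fm i) => h1 h2.
  by have -> : x 0 i = x 0 a by lra.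
rewrite mulr0 add0r; have := wx _ _ (bm i iS'); have := wx _ _ (lm i) => h1 h2.
by have -> : x 0 i = x 0 b by lra.
Qed.

(* All terms of [0 = pairing m0 y = \sum_T msum m0 T * pairing (mu w T) y] are
   nonnegative, so the one for S vanishes and m0 vanishes on the ray of S. *)
Lemma face_ray w m0 (tau : set 'rV[R]_n) S y : dual_cone (chamber R w) m0 ->
  tau = chamber R w `&` [set x | pairing m0 x = 0] -> proper_subset S ->
  tau y -> pairing (mu w S) y != 0 -> ray R S `<=` tau.
Proof.
move=> [m0M dm0] tE pS; rewrite {1}tE => - [wy /= py] muy.
have iS : initial w S.
  by apply: contraNT muy => /negPf iS; rewrite /mu iS andbF pairing0l.
have ge0 T : initial w T -> 0 <= msum m0 T.
  by move=> /indic_chamber /dm0; rewrite pairing_indic // ler0z.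
move: py; rewrite (pairing_sum_mu w _ m0M) => /psumr_eq0P => /(_ _)/(_ _)/= H.
have {H} := H _ S pS.
have mT T : proper_subset T -> 0 <= (msum m0 T)%:~R * pairing (mu w T) y.
  move=> pT; have [iT|/negPf iT] := boolP (initial w T).
    by rewrite mulr_ge0 ?ler0z ?ge0 ?pairing_mu_ge0.
  by rewrite /mu iT andbF pairing0l mulr0.
move=> /(_ mT) /eqP; rewrite mulf_eq0 (negPf muy) orbF intr_eq0 => /eqP mS0.
move=> _ [c [d [c0 ->]]]; rewrite tE; split; last by rewrite /= pairing_ray // mS0 mulr0.
move=> i j ij; rewrite !mxE lerD2r ler_wpM2l //.
by have := indic_chamber iS ij; rewrite !mxE.
Qed.

(** Divisibility of characters: if [chi^m] is regular on the chart of [tau] and its exponent is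
    positive on [e_S], dividing by the character of [mu w S] keeps it regular. In the dual basis the
    coefficient at [S] drops by 1; any other term that is nonzero on [tau] belongs to a ray of
    [tau], where [m] is nonnegative. *)
Lemma dual_sub_mu w m0 (tau : set 'rV[R]_n) S m : dual_cone (chamber R w) m0 ->
  tau = chamber R w `&` [set x | pairing m0 x = 0] -> proper_subset S ->
  dual_cone tau m -> 1 <= msum m S -> dual_cone tau (m - mu w S).
Proof.
move=> dm0 tE pS [mM dm] mS1; split; first exact/latticeMB/latticeM_mu.
move=> y ty; rewrite pairingBl (pairing_sum_mu w _ mM) (bigD1 S) //=.
have wy : chamber R w y by move: ty; rewrite tE => -[].
rewrite addrAC -[X in _ - X]mul1r -mulrBl addr_ge0 //.
  by rewrite mulr_ge0 ?pairing_mu_ge0 // subr_ge0 ler1z.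
apply: sumr_ge0 => T /andP [pT _].
have [->|muy] := eqVneq (pairing (mu w T) y) 0; first by rewrite mulr0.
rewrite mulr_ge0 ?pairing_mu_ge0 // ler0z; apply: dual_ray.
exact: dual_anti (face_ray dm0 tE pT ty muy) _ (conj mM dm).
Qed.

End Fan.

(** * One-parameter subgroups that separate exponents *)

Section OneParameter.
Local Open Scope ring_scope.

Lemma nat_nonroot (D : idomainType) (P : {poly D}) : [pchar D] =i pred0 ->
  P != 0 -> exists N : nat, P.[N%:R] != 0.
Proof.
move=> /pcharf0P char0 P0; apply/not_existsP => H.
pose rs : seq D := [seq i%:R | i <- iota 0 (size P)].
have inj : injective (fun i : nat => i%:R : D).
  have le i j : (i <= j)%N -> i%:R = j%:R :> D -> i = j.
    move=> ij /eqP; rewrite eq_sym -subr_eq0 -natrB // char0 subn_eq0 => ji.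
    by apply/eqP; rewrite eqn_leq ij.
  move=> i j ij; case/orP: (leq_total i j) => h; first exact: le.
  by apply/esym/le.
have := max_poly_roots P0 (rs := rs); rewrite size_map size_iota ltnn.
suff: all (root P) rs && uniq rs by move=> /andP [-> ->] /(_ isT isT).
apply/andP; split; last by rewrite map_inj_uniq ?iota_uniq.
apply/allP => _ /mapP [i _ ->]; apply/rootP/eqP.
by apply/negPn/negP; exact: H.
Qed.

Variable n : nat.

(** The pairing of [m] with [(1, N, N^2, ...)]: a family of one-parameter subgroups indexed by one
    integer, so that separating finitely many exponents amounts to avoiding the roots of a
    polynomial. *)
Definition weight (N : nat) (m : 'rV[int]_n) : int := (rVpoly m).[N%:R].

Lemma weightD N m m' : weight N (m + m') = weight N m + weight N m'.
Proof. by rewrite /weight linearD hornerD. Qed.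

Lemma weight0 N : weight N 0 = 0.
Proof. by rewrite /weight linear0 horner0. Qed.

Lemma weight_separates (s : seq 'rV[int]_n) :
  exists N, {in s &, injective (weight N)}.
Proof.
pose P : {poly int} := \prod_(a <- s) \prod_(b <- s | a != b) rVpoly (a - b).
have [|N] := @nat_nonroot int P (pchar_num _).
  rewrite prodf_seq_neq0; apply/allP => a _ /=; rewrite prodf_seq_neq0; apply/allP => b _ /=.
  apply/implyP; apply: contra => /eqP ab.
  by rewrite -subr_eq0 -[a - b]rVpolyK ab linear0.
move=> H; exists N => a b as_ bs ab; apply/eqP; apply: contraNT H => nab.
rewrite /P horner_prod (big_rem a) //= horner_prod (big_rem b) //= nab.
by rewrite linearB hornerD hornerN -/(weight N a) -/(weight N b) ab subrr !mul0r.
Qed.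

Variable K : fieldType.
Implicit Types p q : seq (K * 'rV[int]_n).

(** A list may repeat an exponent, so equal exponents are collected before a nonzero coefficient is
    sought. The values [F] are arbitrary, which allows characters extended by 0. *)
Lemma coef_neq0 p (F : 'rV[int]_n -> K) : \sum_(c <- p) c.1 * F c.2 != 0 ->
  exists2 m, m \in map snd p & \sum_(c <- p | c.2 == m) c.1 != 0.
Proof.
have -> : \sum_(c <- p) c.1 * F c.2 =
    \sum_(m <- undup (map snd p)) (\sum_(c <- p | c.2 == m) c.1) * F m.
  under [RHS]eq_bigr do rewrite mulr_suml big_mkcond.
  rewrite exchange_big /=; apply: eq_big_seq => c cp.
  rewrite (bigD1_seq c.2) ?undup_uniq ?mem_undup ?map_f //= eqxx big1 ?addr0 // => m.
  by rewrite eq_sym => /negPf ->.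
move=> nz; have [//|H] := pselect (exists2 m, m \in map snd p & \sum_(c <- p | c.2 == m) c.1 != 0).
case/eqP: nz; rewrite big_seq big1 // => m; rewrite mem_undup => mp.
have [->|m0] := eqVneq (\sum_(c <- p | c.2 == m) c.1) 0; first by rewrite mul0r.
by case: H; exists m.
Qed.

(* Restricting to a one-parameter subgroup that separates the exponents reduces
   to polynomials in one variable. *)
Lemma laurent_nonvanishing p q (F G : 'rV[int]_n -> K) : [pchar K] =i pred0 ->
  \sum_(c <- p) c.1 * F c.2 != 0 -> \sum_(c <- q) c.1 * G c.2 != 0 ->
  exists N t, [/\ t != 0, \sum_(c <- p) c.1 * t ^ weight N c.2 != 0 &
    \sum_(c <- q) c.1 * t ^ weight N c.2 != 0].
Proof.
move=> char0 /coef_neq0 [m mp pm] /coef_neq0 [m' mq qm'].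
pose s := map snd p ++ map snd q.
have [N inj] := weight_separates s.
(* Multiplication by [t ^ b] makes all exponents nonnegative, which turns both sums into polynomials
   in [t]. *)
pose b := (\sum_(a <- s) `|weight N a|)%N.
have be a : a \in s -> 0 <= weight N a + b%:Z.
  by move=> as_; rewrite /b (big_rem a) //=; lia.
pose e a := `|(weight N a + b%:Z)%R|%N.
have einj : {in s &, injective e}.
  move=> a a' as_ a's; rewrite /e => E; apply: inj => //.
  by have := be a as_; have := be a' a's; lia.
pose P l : {poly K} := \sum_(c <- l) c.1 *: 'X^(e c.2).
have Pt l t : t != 0 -> {subset map snd l <= s} ->
    (P l).[t] = t ^+ b * \sum_(c <- l) c.1 * t ^ weight N c.2.
  move=> t0 ls; rewrite /P horner_sum mulr_sumr; apply: eq_big_seq => c cl.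
  rewrite hornerZ hornerXn mulrCA; congr (_ * _).
  rewrite !exprnP -expfzDr // addrC; congr (t ^ _).
  by rewrite /e gez0_abs ?be ?ls ?map_f // addrC.
have P0 l a : {subset map snd l <= s} -> a \in map snd l ->
    \sum_(c <- l | c.2 == a) c.1 != 0 -> P l != 0.
  move=> ls al; apply: contra => /eqP Pl0; apply/eqP.
  transitivity ((P l)`_(e a)); last by rewrite Pl0 coef0.
  rewrite /P coef_sum big_mkcond; apply: eq_big_seq => c cl.
  rewrite coefZ coefXn (inj_in_eq einj) ?ls ?map_f // [a == _]eq_sym.
  by case: eqP; rewrite ?mulr1 ?mulr0.
have sp : {subset map snd p <= s} by move=> a; rewrite mem_cat => ->.
have sq : {subset map snd q <= s} by move=> a; rewrite mem_cat orbC => ->.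
(* The factor ['X] ensures that [t] is nonzero. *)
have [|t] := @nat_nonroot K ('X * (P p * P q)) char0.
  by rewrite !mulf_neq0 ?polyX_eq0 ?(P0 p m) ?(P0 q m').
rewrite !hornerM hornerX; set u := t%:R; rewrite !mulf_eq0 !negb_or.
move=> /and3P [u0]; rewrite !Pt // !mulf_eq0 !negb_or.
by move=> /andP [_ pu] /andP [_ qu]; exists N, u.
Qed.

End OneParameter.

(** * Local equations of the ray divisors compared with characters *)

Section Local.
Local Open Scope classical_set_scope.
Local Open Scope ring_scope.
Variables (R : realType) (k : fieldType) (n : nat).
Local Notation X := (Perm R k n).
Implicit Types (U V W : opens X) (x y z : X) (m : 'rV[int]_n) (S : {set 'I_n}).
Implicit Types (sigma tau : set 'rV[R]_n) (p q : laurent k n).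

Lemma pval_torus x m : torus x -> latticeM m -> pval x m != 0.
Proof.
by move=> tx mM; apply/eqP/pval_perp; rewrite tx; exact: perp_zero_cone.
Qed.

Lemma perp_dual sigma m : perp sigma m -> dual_cone sigma m.
Proof. by move=> [mM pm]; split=> // x /pm ->. Qed.

Lemma pval_torusD x m m' : torus x -> latticeM m -> latticeM m' ->
  pval x (m + m') = pval x m * pval x m'.
Proof.
by move=> tx mM m'M; apply: pvalD; rewrite tx; exact/perp_dual/perp_zero_cone.
Qed.

(** The distinguished point of the orbit of the ray, moved by [t] through the one-parameter subgroup
    of weight [N]. Multiplicativity holds because two nonnegative values on [e_S] sum to 0 only if
    both are 0. *)
Lemma ray_orbit_point w S N (t : k) : proper_subset S -> initial w S -> t != 0 ->
  exists y : X, pcone y = ray R S /\ forall m, latticeM m ->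
    pval y m = if msum m S == 0 then t ^ weight N m else 0.
Proof.
move=> pS iS t0.
pose v m := if (\sum_i m 0 i == 0) && (msum m S == 0) then t ^ weight N m else 0.
have v0 : v 0 = 1.
  have /eqP M0 : @latticeM n 0 by exact: latticeM0.
  have s0 : msum 0 S = 0 by rewrite /msum big1 // => i _; rewrite mxE.
  by rewrite /v M0 s0 eqxx weight0.
have vD m m' : dual_cone (ray R S) m -> dual_cone (ray R S) m' ->
    v (m + m') = v m * v m'.
  move=> dm dm'; have [/eqP sM _] := dualD dm dm'.
  have [/eqP mM _] := dm; have [/eqP m'M _] := dm'.
  have mS := dual_ray dm; have m'S := dual_ray dm'.
  rewrite /v sM mM m'M msumD paddr_eq0 //=.
  by case: eqP; case: eqP; rewrite ?mulr0 ?mul0r //= weightD expfzDr.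
have vP m : v m <> 0 <-> perp (ray R S) m.
  rewrite /v; have [mM|nM] := eqVneq (\sum_i m 0 i) 0; last first.
    by split=> [//|[mM]]; rewrite /latticeM /= in mM; rewrite mM eqxx in nM.
  rewrite perp_ray //=; have [s0|ns] := eqVneq (msum m S) 0.
    by split=> // _; apply/eqP; rewrite expfz_neq0.
  by split=> // s0; rewrite s0 eqxx in ns.
exists (PermPoint (braid_fan_ray R pS iS) v0 vD vP); split=> // m mM.
by rewrite /= /v mM eqxx.
Qed.

Lemma open_basic sigma p : braid_fan sigma -> coord_ring sigma p ->
  open (basic_open sigma p : set X).
Proof. by move=> fs ps; apply/perm_openE => x px; exists sigma, p; split. Qed.

(** Extension by 0 to the whole variety, so that functions on different open sets are compared at
    points without membership proofs. *)
Definition ext V (h : OX V) (y : X) : k :=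
  if pselect (opens_set V y) is left Vy then h (exist _ y (mem_set Vy)) else 0.

Lemma extE V (h : OX V) (y : V) : ext h (val y) = h y.
Proof.
rewrite /ext; case: pselect => [Vy|nV]; first by congr (OX_fun h _); exact: val_inj.
by case: nV; exact: set_mem (valP y).
Qed.

Lemma ext_res U V (s : U `<=` V) (h : OX V) y :
  opens_set U y -> ext (OX_res s h) y = ext h y.
Proof.
move=> Uy; pose y' : U := exist _ y (mem_set Uy).
exact: etrans (extE (OX_res s h) y') (esym (extE h (incl s y'))).
Qed.

Lemma extM V (f g : OX V) y : opens_set V y -> ext (f * g) y = ext f y * ext g y.
Proof. by move=> Vy; rewrite -[y]/(val (exist _ y (mem_set Vy) : V)) !extE. Qed.

Lemma ext1 V y : opens_set V y -> ext (1 : OX V) y = 1.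
Proof. by move=> Vy; rewrite -[y]/(val (exist _ y (mem_set Vy) : V)) !extE. Qed.

Lemma OX_ext V (f g : OX V) :
  (forall y, opens_set V y -> ext f y = ext g y) -> f = g.
Proof.
move=> fg; apply: val_inj; apply/funext => y; rewrite /= -!extE.
exact/fg/set_mem/(valP y).
Qed.

Lemma OX_frac sigma p q W : braid_fan sigma -> coord_ring sigma p ->
  coord_ring sigma q -> W `<=` basic_open sigma q ->
  exists f : OX W, forall y, opens_set W y -> ext f y = leval p y / leval q y.
Proof.
move=> fs ps qs Wq.
have rf : (fun y : W => leval p (val y) / leval q (val y)) \in @reg_pred k X W.
  rewrite inE => x; exists W, sigma, p, q; split=> //.
    exact: set_mem (valP x).
  by move=> y Wy; have [] := Wq _ Wy.
exists (Regular rf) => y Wy.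
by rewrite -[y]/(val (exist _ y (mem_set Wy) : W)) extE.
Qed.

(** Agreement is required on the torus only: sections of O(D) live there, and the quotients
    [chi / h] below may have vanishing denominators elsewhere. *)
Definition reg_at (x : X) (F : X -> k) : Prop :=
  exists W (psi : OX W), opens_set W x /\
    forall y, torus y -> opens_set W y -> F y = ext psi y.

Lemma reg_atM x F G : reg_at x F -> reg_at x G -> reg_at x (fun y => F y * G y).
Proof.
move=> [W [f [Wx Ff]]] [W' [g [W'x Gg]]].
have s : opensI W W' `<=` W by move=> y [].
have s' : opensI W W' `<=` W' by move=> y [].
exists (opensI W W'), (OX_res s f * OX_res s' g); split=> // y ty [Wy W'y].
by rewrite extM // !ext_res // Ff // Gg.
Qed.

Lemma reg_at1 x : reg_at x (fun=> 1).
Proof.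
exists (Opens (@openT X)), 1; split=> // y _ _.
by rewrite ext1.
Qed.

Lemma reg_at_prod x (I : Type) (r : seq I) (P : pred I) (F : I -> X -> k) :
  (forall i, P i -> reg_at x (F i)) ->
  reg_at x (fun y => \prod_(i <- r | P i) F i y).
Proof.
move=> H; elim: r => [|i r IH].
  by under eq_fun do rewrite big_nil; exact: reg_at1.
under eq_fun do rewrite big_cons.
by case Pi: (P i) => //; apply: reg_atM => //; exact: H.
Qed.

Lemma reg_atXn x F d : reg_at x F -> reg_at x (fun y => F y ^+ d).
Proof.
move=> rF; elim: d => [|d IH]; first by under eq_fun do rewrite expr0; exact: reg_at1.
by under eq_fun do rewrite exprS; exact: reg_atM.
Qed.

Lemma reg_at_near x F G V : opens_set V x ->
  (forall y, torus y -> opens_set V y -> F y = G y) -> reg_at x F -> reg_at x G.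
Proof.
move=> Vx FG [W [f [Wx Ff]]].
have s : opensI W V `<=` W by move=> y [].
exists (opensI W V), (OX_res s f); split=> // y ty [Wy Vy].
by rewrite ext_res // -Ff // FG.
Qed.

Lemma reg_at_ext x V (h : OX V) : opens_set V x -> reg_at x (ext h).
Proof. by move=> Vx; exists V, h. Qed.

Lemma reg_at_frac x sigma p q : braid_fan sigma -> coord_ring sigma p ->
  coord_ring sigma q -> basic_open sigma q x ->
  reg_at x (fun y => leval p y / leval q y).
Proof.
move=> fs ps qs qx; pose W : opens X := Opens (open_basic fs qs).
have [f fE] := @OX_frac sigma p q W fs ps qs (subset_refl (A := W)).
by exists W, f; split=> // y _ Wy; rewrite fE.
Qed.

Lemma leval1 c m x : leval [:: (c, m)] x = c * pval x m.
Proof. by rewrite /leval big_seq1. Qed.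

Lemma coord_ring1 sigma c m : dual_cone sigma m -> coord_ring sigma [:: (c : k, m)].
Proof. by move=> dm d; rewrite inE => /eqP ->. Qed.

Lemma local_equation_vanish V (Z : set X) (h : OX V) : local_equation Z h ->
  forall z, opens_set V z -> Z z -> ext h z = 0.
Proof.
move=> hZ z Vz Zz; have hh : exists f, h = OX_res (subset_refl (A := V)) h * f.
  by exists 1; rewrite mulr1; apply: OX_ext => y Vy; rewrite ext_res.
have H := (hZ V (subset_refl (A := V)) h).2 hh.
by rewrite -[z]/(val (exist _ z (mem_set Vz) : V)) extE H.
Qed.

Section AtPoint.
Variables (x : X) (w : 'S_n) (m0 : 'rV[int]_n) (S : {set 'I_n}).
Local Notation tau := (pcone x).
Local Notation chi := (mu w S).
Hypothesis dm0 : dual_cone (chamber R w) m0.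
Hypothesis tauE : tau = chamber R w `&` [set x | pairing m0 x = 0].
Hypothesis pS : proper_subset S.

Let fx : braid_fan tau := pcone_fan x.

Let dchi : dual_cone tau chi.
Proof.
split; first exact: latticeM_mu.
by rewrite tauE => y [wy _]; exact: pairing_mu_ge0.
Qed.

Let chi_ray z : chart tau z -> pcone z = ray R S -> pval z chi = 0.
Proof.
move=> tz zS; apply: contrapT => /pval_perp.
rewrite zS perp_ray; last exact: latticeM_mu.
rewrite msum_mu //; apply: (ray_initial pS) (_ : ray R S `<=` chamber R w).
by rewrite -zS; apply: subset_trans tz _; rewrite tauE => y [].
Qed.

Let basic_chi := basic_open tau [:: (1 : k, chi)].

Let open_chi : open (basic_chi : set X).
Proof. by apply: open_basic => //; exact: coord_ring1. Qed.

Let basic_chiP z : basic_chi z <-> chart tau z /\ pval z chi <> 0.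
Proof. by rewrite /basic_chi /basic_open /= leval1 mul1r. Qed.

Let chi_divisor z : chart tau z -> @ray_divisor R k n S z -> pval z chi = 0.
Proof.
(* Nonvanishing of [chi] is open, so a point of the closure where it held would yield a point of the
   orbit where it holds. *)
move=> tz Dz; apply: contrapT => cz.
have /Dz : nbhs z (basic_chi : set X).
  by apply: open_nbhs_nbhs; split=> //; apply/basic_chiP.
by move=> [z' [z'S /basic_chiP [tz']]]; apply; exact: chi_ray.
Qed.

Variables (V : opens X) (h : OX V).
Hypothesis Vx : opens_set V x.
Hypothesis hS : local_equation (@ray_divisor R k n S) h.

(** Where [chi] does not vanish there is no point of [D_S], so 1 lies vacuously in the ideal of
    [D_S] and is a multiple of [h]. *)
Let local_inverse : pval x chi <> 0 ->
  exists W (f : OX W), opens_set W x /\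
    forall y, opens_set W y -> ext h y * ext f y = 1.
Proof.
move=> cx; pose W := opensI V (Opens open_chi).
have s : W `<=` V by move=> y [].
have Wx : opens_set W x by split=> //; apply/basic_chiP; split.
have [|f fE] := (hS s 1).1.
  move=> z Dz; have [_ /basic_chiP [tz]] := set_mem (valP z).
  by case; exact: chi_divisor.
exists W, f; split=> // y Wy.
by rewrite -(ext_res s) // -extM // -fE ext1.
Qed.

Lemma local_equation_neq0 : torus x -> ext h x != 0.
Proof.
move=> tx; have [|W [f [Wx /(_ _ Wx) hf]]] := local_inverse.
  by apply/eqP/pval_torus => //; exact: latticeM_mu.
by apply/eqP => h0; move/eqP: hf; rewrite h0 mul0r eq_sym oner_eq0.
Qed.

Let local_unit : pval x chi <> 0 ->
  reg_at x (fun y => pval y chi / ext h y) /\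
  reg_at x (fun y => ext h y / pval y chi).
Proof.
move=> cx; have [W [f1 [Wx hf]]] := local_inverse cx.
have rc : reg_at x (fun y => pval y chi).
  have := reg_at_frac (p := [:: (1, chi)]) (q := [:: (1, 0)]) fx.
  move=> /(_ x) H; apply: reg_at_near Vx _ (H _ _ _).
  - by move=> y _ _; rewrite !leval1 pval0 !mul1r divr1.
  - exact: coord_ring1.
  - exact: coord_ring_cst.
  - by split=> //=; rewrite leval_cst; apply/eqP/oner_neq0.
have rc' : reg_at x (fun y => (pval y chi)^-1).
  have := reg_at_frac (p := [:: (1, 0)]) (q := [:: (1, chi)]) fx.
  move=> /(_ x) H; apply: reg_at_near Vx _ (H _ _ _).
  - by move=> y _ _; rewrite !leval1 pval0 !mul1r.
  - exact: coord_ring_cst.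
  - exact: coord_ring1.
  - by split=> //=; rewrite leval1 mul1r.
split; apply: reg_atM => //; last exact: reg_at_ext.
apply: reg_at_near Wx _ (reg_at_ext f1 Wx) => y _ Wy.
have hy : ext h y != 0.
  by apply/eqP => h0; have /eqP := hf y Wy; rewrite h0 mul0r eq_sym oner_eq0.
by apply: (mulfI hy); rewrite hf // divff.
Qed.

Hypothesis char0 : [pchar k] =i pred0.

(* Near x the equation h is p/q, where p vanishes at the points of the orbit of the ray of
   S at which r is nonzero.  As r(x) <> 0, the restriction of r to this orbit is not
   formally zero, so that of p is, i.e. chi divides p. *)
Let local_vanish : pval x chi = 0 ->
  reg_at x (fun y => pval y chi / ext h y) /\
  reg_at x (fun y => ext h y / pval y chi).
Proof.
move=> cx.
have iS : initial w S.
  apply/negPn/negP => /negPf iS; move: cx; rewrite /mu iS andbF pval0 => /eqP.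
  by rewrite oner_eq0.
have St : ray R S `<=` tau.
  have : ~ perp tau chi by move=> /pval_perp.
  move=> np; have [y ty cy] : exists2 y, tau y & pairing chi y != 0.
    apply: contrapT => ny; apply: np; split; first exact: latticeM_mu.
    by move=> y ty; apply/eqP/negPn/negP => cy; apply: ny; exists y.
  exact: face_ray dm0 tauE pS ty cy.
have tx : chart tau x by [].
split.
  pose W := opensI V (Opens (open_chart (k := k) fx)).
  have s : W `<=` V by move=> y [].
  have Wx : opens_set W x by split.
  have Wc : W `<=` basic_open tau [:: (1 : k, 0)].
    by move=> y [_ ty]; split=> //=; rewrite leval_cst; apply/eqP/oner_neq0.
  have [c cE] := OX_frac fx (coord_ring1 (c := 1) dchi) (@coord_ring_cst R k n tau 1) Wc.
  have cE' y : opens_set W y -> ext c y = pval y chi.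
    by move=> Wy; rewrite cE // !leval1 pval0 !mul1r divr1.
  (* [chi] vanishes on [D_S], hence [chi = h * v]; off the zeros of [h] the quotient is [v]. *)
  have [|v vE] := (hS s c).1.
    move=> z Dz; rewrite -extE cE'; last exact: set_mem (valP z).
    by apply: chi_divisor => //; have [] := set_mem (valP z).
  apply: reg_at_near Wx _ (reg_at_ext v Wx) => y ty Wy.
  have := cE' y Wy; rewrite vE extM // ext_res // => <-.
  rewrite mulrAC divff ?mul1r //; apply/eqP => h0.
  have /eqP := pval_torus ty (latticeM_mu w S).
  by rewrite -cE' // vE extM // ext_res // h0 mul0r.
have hD := local_equation_vanish hS.
have := OX_reg h; rewrite inE => /(_ (exist _ x (mem_set Vx))) /=.
move=> [V' [s' [p [q [V'x fs' ps' qs' hpq]]]]].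
have [xs' qx _] := hpq (exist _ x (mem_set Vx)) V'x.
pose V1 := opensI V (opensI V' (Opens (open_chart (k := k) fx))).
(* Shrinking to a basic open set given by [r] replaces membership in the domain of [h = p / q] by
   nonvanishing of a Laurent polynomial, a condition that can be tested on the orbit. *)
have /perm_openE := opens_open V1.
move=> /(_ x) [|s1 [r [fs1 rs1 [xs1 rx] rV1]]]; first by split.
have pt := coord_ring_anti xs' ps'; have qt := coord_ring_anti xs' qs'.
have rt := coord_ring_anti xs1 rs1.
have hE y : chart tau y -> leval r y <> 0 ->
    [/\ opens_set V y, leval q y <> 0 & ext h y = leval p y / leval q y].
  move=> ty ry; have [Vy [V'y _]] : opens_set V1 y.
    by apply: rV1; split=> // z /ty; exact: xs1.
  have [_ qy hy] := hpq (exist _ y (mem_set Vy)) V'y; split=> //.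
  by rewrite -hy -extE.
(* [flt f] is the part of [f] that survives on the orbit of the ray; the remaining terms are
   divisible by [chi], with quotient [shift f]. *)
pose flt (f : laurent k n) := [seq c <- f | msum c.2 S == 0].
pose shift (f : laurent k n) := [seq (c.1, c.2 - chi) | c <- f & msum c.2 S != 0].
have dS c (f : laurent k n) : coord_ring tau f -> c \in f -> 0 <= msum c.2 S.
  by move=> ft cf; apply: dual_ray; exact: dual_anti St _ (ft _ cf).
have shift_t (f : laurent k n) : coord_ring tau f -> coord_ring tau (shift f).
  move=> ft c /mapP [d]; rewrite mem_filter => /andP [ds df] -> /=.
  apply: (dual_sub_mu dm0 tauE pS (ft _ df)).
  by rewrite -gtz0_ge1 lt_def ds (dS _ _ ft df).
have split_f (f : laurent k n) y : coord_ring tau f -> chart tau y ->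
    leval f y = leval (flt f) y + pval y chi * leval (shift f) y.
  move=> ft ty; rewrite /leval (bigID (fun c => msum c.2 S == 0)) /=.
  rewrite big_filter; congr (_ + _).
  rewrite big_map big_filter mulr_sumr big_seq_cond [RHS]big_seq_cond.
  apply: eq_bigr => c /andP [cf cS]; rewrite mulrCA; congr (_ * _).
  have dc : dual_cone tau (c.2 - chi).
    by apply: shift_t ft (c.1, _) _; apply/mapP; exists c; rewrite // mem_filter cS.
  rewrite -[in LHS](subrK chi c.2) mulrC; apply: pvalD; exact: dual_anti ty _ _.
(* Since [chi] vanishes at [x], [r] and [flt r] agree there, so [flt r] is nonzero. If [flt p] were
   nonzero somewhere, some point of the orbit would have both nonzero, and [h] would not vanish at
   this point of [D_S]. *)
have flt0 y : chart tau y -> leval (flt p) y = 0.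
  move=> ty; have [//|p0] := eqVneq (leval (flt p) y) 0.
  case: rx; rewrite (split_f _ _ rt tx) cx mul0r addr0.
  apply/eqP/negPn/negP => r0.
  have [N [t [t0 pt0 rt0]]] := laurent_nonvanishing char0 p0 r0.
  have [z [zS zE]] := ray_orbit_point N pS iS t0.
  have tz : chart tau z by rewrite /chart /= zS.
  have zc : pval z chi = 0 by exact: chi_ray.
  have fE (f : laurent k n) : coord_ring tau f ->
      leval f z = \sum_(c <- flt f) c.1 * t ^ weight N c.2.
    move=> ft; rewrite (split_f _ _ ft tz) zc mul0r addr0.
    rewrite /leval big_seq_cond [RHS]big_seq_cond; apply: eq_bigr => c.
    rewrite andbT mem_filter => /andP [cS cf]; rewrite zE ?cS //.
    by have [] := ft _ cf.
  have rz : leval r z <> 0 by apply/eqP; rewrite fE.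
  have [Vz qz hz] := hE z tz rz.
  have /(hD z Vz)/eqP : @ray_divisor R k n S z by apply: subset_closure.
  rewrite hz.
  rewrite mulf_eq0 invr_eq0 (negPf (introN eqP qz)) orbF fE //.
  by rewrite (negPf pt0).
pose B := basic_open tau (lmul q r).
have qrt : coord_ring tau (lmul q r) by exact: coord_ring_mul.
have BE y : chart tau y -> leval (lmul q r) y = leval q y * leval r y.
  by move=> ty; rewrite (leval_mul qt rt ty).
have Bx : B x.
  split=> //=; rewrite BE //; apply/eqP; rewrite mulf_neq0 //; exact/eqP.
have H := reg_at_frac fx (coord_ring_mul (shift_t _ pt) rt) qrt Bx.
apply: (@reg_at_near x _ _ (Opens (open_basic fx qrt)) Bx _ H).
move=> y ty [tcy /=]; rewrite BE // => /eqP; rewrite mulf_eq0 negb_or => /andP [qy ry].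
have [_ _ ->] := hE y tcy (elimN eqP ry).
rewrite (leval_mul (shift_t _ pt) rt tcy) -mulf_div divff // mulr1.
rewrite (split_f _ _ pt tcy) flt0 // add0r mulrAC [pval _ _ * _]mulrC mulfK //.
exact: pval_torus ty (latticeM_mu w S).
Qed.

(** Both quotients are regular near [x], that is, [h] and [chi] differ by a unit. *)
Lemma chi_local_equation :
  reg_at x (fun y => pval y chi / ext h y) /\
  reg_at x (fun y => ext h y / pval y chi).
Proof.
by have [c0|/eqP c0] := eqVneq (pval x chi) 0; [exact: local_vanish|exact: local_unit].
Qed.

End AtPoint.
End Local.

(** * Multiplication by a character and linear equivalence *)

Section LinearEquivalence.
Local Open Scope classical_set_scope.
Local Open Scope ring_scope.
Variables (R : realType) (k : fieldType) (n : nat).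
Hypothesis char0 : [pchar k] =i pred0.
Local Notation X := (Perm R k n).
Implicit Types (U V W : opens X) (x y : X) (m : 'rV[int]_n) (S : {set 'I_n}).
Implicit Types (a b : {set 'I_n} -> int).

Lemma pval_torusV x m : torus x -> latticeM m -> pval x (- m) = (pval x m)^-1.
Proof.
move=> tx mM; apply: (mulfI (pval_torus tx mM)).
by rewrite -pval_torusD // ?subrr ?pval0 ?divff ?pval_torus //; exact: latticeMN.
Qed.

Lemma latticeMZ (c : int) m : latticeM m -> latticeM (c *: m).
Proof.
rewrite /latticeM /= => mM; under eq_bigr do rewrite mxE.
by rewrite -mulr_sumr mM mulr0.
Qed.

Lemma pval_torusZ x m (c : int) : torus x -> latticeM m ->
  pval x (c *: m) = pval x m ^ c.
Proof.
move=> tx mM.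
have nat_case (d : nat) : pval x (d%:Z *: m) = pval x m ^+ d.
  elim: d => [|d IH]; first by rewrite scale0r pval0.
  by rewrite intS scalerDl scale1r pval_torusD ?IH ?exprS //; exact: latticeMZ.
case: c => d; first by rewrite nat_case.
by rewrite NegzE scaleNr pval_torusV ?nat_case //; exact: latticeMZ.
Qed.

Lemma pval_torus_mu w x m : torus x -> latticeM m ->
  pval x m = \prod_(S | proper_subset S) pval x (mu w S) ^ msum m S.
Proof.
move=> tx mM; rewrite {1}(sum_mu w mM).
(* Membership in M is carried along the sum because [pval] is multiplicative only there. *)
pose K (m' : 'rV[int]_n) (c : k) := latticeM m' /\ pval x m' = c.
suff [] : K (\sum_(S | proper_subset S) msum m S *: mu w S)
    (\prod_(S | proper_subset S) pval x (mu w S) ^ msum m S) by [].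
apply: (big_rec2 K) => [|S m' c _ [m'M <-]]; first by split; [exact: latticeM0|exact: pval0].
have cM := latticeMZ (msum m S) (latticeM_mu w S).
split; last by rewrite pval_torusD // pval_torusZ //; exact: latticeM_mu.
by rewrite -[m']opprK; apply: latticeMB => //; exact: latticeMN.
Qed.

(** Near [x] take a chamber having the cone of [x] as a face and write [chi_S] for the character of
    [mu w S]. Then [chi^m] is the product of the [chi_S ^ msum m S], and passing from [a] to [b]
    multiplies the local equation by the [h_S ^ (- msum m S)]. The total factor is the product of
    the [(chi_S / h_S) ^ msum m S], regular for either sign of the exponents. *)
Lemma div_section_chi a b m U (phi : torus_fun U) : latticeM m ->
  (forall S, proper_subset S -> b S = a S - msum m S) -> div_section a phi ->
  div_section b ((fun y : (U `&` @torus R k n) => pval (val y) m * phi y) : torus_fun U).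
Proof.
move=> mM ba Hphi x V s h Vx hh.
have [W [t [psi [Wx H]]]] := Hphi x V s h Vx hh.
have [w [m0 [dm0 tE]]] := pcone_fan (val x).
have [W1 [psi1 [W1x H1]]] : reg_at (val x) (fun y =>
    \prod_(S | proper_subset S) (pval y (mu w S) / ext (h S) y) ^ msum m S).
  apply: reg_at_prod => S pS.
  have [r1 r2] := chi_local_equation dm0 tE pS Vx (hh S pS) char0.
  case: (msum m S) => d; first exact: reg_atXn.
  have := reg_atXn d.+1 r2; congr (reg_at _ _); apply/funext => y.
  by rewrite NegzE -exprnN -exprVn invf_div.
have s0 : opensI W W1 `<=` W by move=> y [].
have s1 : opensI W W1 `<=` W1 by move=> y [].
exists (opensI W W1), (subset_trans s0 t), (OX_res s0 psi * OX_res s1 psi1).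
split=> // y; have [[Wy W1y] ty] := set_mem (valP y).
have Vy := t _ Wy.
have hE (A : set X) (t' : A `<=` V) (z : A) S :
    h S (incl t' z) = ext (h S) (val z).
  by rewrite -extE.
pose y0 := incl (torus_sub s0) y.
have Hy := H y0; rewrite -(extE psi) /= in Hy.
rewrite -[RHS]extE extM //= !ext_res // -H1 // -Hy.
rewrite (_ : incl _ y0 = incl (torus_sub (subset_trans (subset_trans s0 t) s)) y);
  last exact: val_inj.
rewrite -!mulrA mulrCA; congr (_ * _).
under eq_bigr do rewrite hE; under [X in _ = X * _]eq_bigr do rewrite hE.
rewrite /= (pval_torus_mu w ty mM) -!big_split /=; apply: eq_bigr => S pS.
have [w' [m0' [_ tE']]] := pcone_fan (val y).
have h0 : ext (h S) (val y) != 0.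
  exact: (local_equation_neq0 tE' pS Vy (hh S pS) ty).
by rewrite ba // expfzDr // expfzMl mulrCA exprz_inv.
Qed.

End LinearEquivalence.

(** * Isomorphisms of the sheaves O(D): characters and transport by the group *)

Section SheafIso.
Local Open Scope classical_set_scope.
Local Open Scope ring_scope.

Lemma modsheaf_iso_trans (k : fieldType) (X : fspace k) (E F G : modsheaf X) :
  modsheaf_iso E F -> modsheaf_iso F G -> modsheaf_iso E G.
Proof.
move=> [f [fb fr]] [g [gb gr]].
exists (fun U => (g U \o f U : {linear _ -> _})); split=> [U|U V s x].
  exact: (bij_comp (gb U) (fb U)).
by rewrite /= fr gr.
Qed.

Variables (R : realType) (k : fieldType) (n : nat).
Local Notation X := (Perm R k n).
Local Notation T := (@torus R k n).
Implicit Types (U V W : opens X) (m : 'rV[int]_n) (S : {set 'I_n}).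
Implicit Types (a b : {set 'I_n} -> int) (g : 'S_2 * 'S_n).

Section MulChi.
Hypothesis char0 : [pchar k] =i pred0.
Variables (a b : {set 'I_n} -> int) (m : 'rV[int]_n).
Hypothesis mM : latticeM m.
Hypothesis ba : forall S, proper_subset S -> b S = a S - msum m S.

Lemma div_chi_subproof U (f : div_sec a U) :
  ((fun y : (U `&` T) => pval (val y) m * div_fun f y) : torus_fun U) \in @div_pred R k n b U.
Proof.
rewrite inE; apply: (div_section_chi char0 mM ba).
by have := div_mem f; rewrite inE.
Qed.

Definition div_chi U (f : div_sec a U) : div_sec b U := DivSec (div_chi_subproof f).

Lemma div_chi_linear U : linear (@div_chi U).
Proof.
move=> c f f'; apply: val_inj; apply/funext => y.
by apply: etrans (mulrDr _ _ _) _; congr (_ + _); exact: mulrCA.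
Qed.

HB.instance Definition _ U :=
  GRing.isLinear.Build _ _ _ _ (@div_chi U) (@div_chi_linear U).
End MulChi.

Lemma div_sheaf_chi a b m : [pchar k] =i pred0 -> latticeM m ->
  (forall S, proper_subset S -> b S = a S - msum m S) ->
  modsheaf_iso (@div_sheaf R k n a) (@div_sheaf R k n b).
Proof.
move=> char0 mM ba.
have NmM := latticeMN mM.
have ab S : proper_subset S -> a S = b S - msum (- m) S.
  by move=> pS; rewrite msumN opprK ba // subrK.
exists (fun U => (div_chi char0 mM ba (U := U) : {linear _ -> _})).
split=> [U|U V s x]; last exact: val_inj.
exists (div_chi char0 NmM ab (U := U)) => f; apply: val_inj; apply/funext => y /=.
- have [_ ty] := set_mem (valP y).
  by rewrite mulrA -pval_torusD // addNr pval0 mul1r.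
- have [_ ty] := set_mem (valP y).
  by rewrite mulrA -pval_torusD // addrN pval0 mul1r.
Qed.

(** The odd element complements because [-e_S] equals [e_(~: S)] up to a multiple of the all-ones
    vector. *)
Definition act_set g S : {set 'I_n} :=
  if odd_perm g.1 then (~: (g.2 @: S))%SET else g.2 @: S.

Lemma in_act_set g S i : (i \in act_set g S) = odd_perm g.1 (+) ((g.2^-1)%g i \in S).
Proof.
rewrite /act_set; have iE : (i \in g.2 @: S) = ((g.2^-1)%g i \in S).
  by rewrite -{1}[i](permKV g.2) mem_imset //; exact: perm_inj.
by case: odd_perm; rewrite ?inE iE.
Qed.

Lemma act_setK g : cancel (act_set g) (act_set g^-1%g).
Proof.
move=> S; apply/setP => i; rewrite !in_act_set /= odd_permV invgK permK.
by rewrite addbA addbb.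
Qed.

Lemma act_setVK g : cancel (act_set g^-1%g) (act_set g).
Proof. by move=> S; rewrite -{1}[g]invgK act_setK. Qed.

Lemma proper_act_set g S : proper_subset (act_set g S) = proper_subset S.
Proof.
(* This form of properness is symmetric under complement. *)
have H A : proper_subset A = [exists i, i \in A] && [exists i, i \notin A].
  rewrite /proper_subset; congr (_ && _).
    by apply/set0Pn/existsP.
  apply/idP/idP => [|/existsP [i]]; last by apply: contra => /eqP ->; rewrite inE.
  apply: contraNT; rewrite negb_exists => /forallP nA.
  by apply/eqP/setP => i; rewrite inE; exact/negPn/nA.
have shift (P : pred 'I_n) : [exists i, P ((g.2^-1)%g i)] = [exists i, P i].
  apply/existsP/existsP => -[i Pi]; first by exists ((g.2^-1)%g i).
  by exists (g.2 i); rewrite permK.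
rewrite !H -(shift (mem S)) -(shift [pred i | i \notin S]).
under eq_existsb do rewrite in_act_set.
under [X in _ && X]eq_existsb do rewrite in_act_set.
case: odd_perm => //=; rewrite andbC; congr (_ && _).
by under eq_existsb do rewrite negbK.
Qed.

Lemma gact_ray g S : gact g @` ray R S = ray R (act_set g S).
Proof.
have sub h (A : {set 'I_n}) : gact h @` ray R A `<=` ray R (act_set h A).
  move=> _ [_ [c [d [c0 ->]]] <-].
  exists c, (if odd_perm h.1 then - d - c else d); split=> //.
  apply/rowP => i; rewrite !mxE in_act_set; case: odd_perm => /=; last first.
    by rewrite expr0 mul1r.
  by rewrite expr1; case: (_ \in A); rewrite /= ?mulr1 ?mulr0; lra.
apply/seteqP; split; first exact: sub.
move=> x Sx; exists (gact g^-1%g x); last by rewrite gactVK.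
by rewrite -[S](act_setK g); apply: sub; exists x.
Qed.

Lemma gact_zero_cone g : gact g @` zero_cone R n = zero_cone R n.
Proof.
have sub h : gact h @` zero_cone R n `<=` zero_cone R n.
  move=> _ [_ [d _ <-] <-]; exists ((-1) ^+ odd_perm h.1 * d) => //.
  by apply/rowP => i; rewrite !mxE.
apply/seteqP; split; first exact: sub.
by move=> x zx; exists (gact g^-1%g x); [apply: sub; exists x|rewrite gactVK].
Qed.

Lemma torus_act g (x : X) : torus x -> torus (act_point g x).
Proof. by rewrite /torus /= => ->; exact: gact_zero_cone. Qed.

Lemma ray_divisor_act g S (x : X) :
  ray_divisor S x -> ray_divisor (act_set g S) (act_point g x).
Proof.
move=> Dx B; rewrite nbhsE => -[O [oO Ox] OB].
have /Dx [z [/= zS Oz]] : nbhs x (act_point g @^-1` O).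
  by apply: open_nbhs_nbhs; split=> //; exact: act_cont.
by exists (act_point g z); split; [rewrite /= zS gact_ray|exact: OB].
Qed.

Local Notation pre g U := (opens_preim (aut_cont (@Perm_action R k n g)) U).

Lemma ext_pull g V (h : OX V) y : opens_set V (act_point g y) ->
  ext (aut_pull (@Perm_action R k n g) h) y = ext h (act_point g y).
Proof.
move=> Vy; pose y' : pre g V := exist _ y (mem_set Vy).
exact: etrans (extE (aut_pull (@Perm_action R k n g) h) y') (esym (extE h (preimage_map y'))).
Qed.

(** A function vanishing on the pulled back divisor is carried over by [g^-1], divided there by [h],
    and the quotient is pulled back by [g]. *)
Lemma local_equation_pull g V S (h : OX V) : local_equation (ray_divisor S) h ->
  local_equation (ray_divisor (act_set g^-1%g S)) (aut_pull (@Perm_action R k n g) h).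
Proof.
move=> hS W s f.
have gW y : opens_set W y -> opens_set V (act_point g y) by move=> /s.
split=> [f0|[u ->] y Dy]; last first.
  have Wy := set_mem (valP y).
  rewrite -extE extM // ext_res // ext_pull; last exact: gW.
  rewrite (local_equation_vanish hS) ?mul0r //; first exact: gW.
  by rewrite -[S](act_setVK g); exact: ray_divisor_act.
have s' : pre g^-1%g W `<=` V by move=> y /s; rewrite /= act_pointVK.
have Wg y : opens_set W y -> opens_set (pre g^-1%g W) (act_point g y).
  by rewrite /= act_pointK.
have [|u uE] := (hS _ s' (aut_pull (@Perm_action R k n g^-1%g) f)).1.
  by move=> y Dy; apply: f0; exact: ray_divisor_act.
have sW : W `<=` pre g (pre g^-1%g W) by move=> y /Wg.
exists (OX_res sW (aut_pull (@Perm_action R k n g) u)); apply: OX_ext => y Wy.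
rewrite extM // !ext_res // !ext_pull; [|exact: Wg|exact: gW].
have <- : ext (aut_pull (@Perm_action R k n g^-1%g) f) (act_point g y) = ext f y.
  by rewrite ext_pull act_pointK.
by rewrite uE extM ?ext_res //; exact: Wg.
Qed.

Lemma torus_preim g U (y : X) : (pre g U `&` T) y -> (U `&` T) (act_point g y).
Proof. by move=> [Uy ty]; split=> //; exact: torus_act. Qed.

Definition torus_map g U (y : pre g U `&` T) : U `&` T :=
  exist _ (act_point g (val y)) (mem_set (torus_preim (set_mem (valP y)))).

(** Arbitrary local equations near [x] are carried by [g^-1] to local equations near [g x], where
    the hypothesis on [phi] applies; the resulting regular function is pulled back. *)
Lemma div_section_pull g a b U (phi : torus_fun U) :
  (forall S, proper_subset S -> b S = a (act_set g S)) -> div_section a phi ->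
  div_section b ((phi \o @torus_map g U) : torus_fun (pre g U)).
Proof.
move=> ba Hphi x V s h Vx hh.
have s' : pre g^-1%g V `<=` U by move=> y /s; rewrite /= act_pointVK.
have V'x : opens_set (pre g^-1%g V) (act_point g (val x)) by rewrite /= act_pointK.
have [|W [t [psi [Wx H]]]] := Hphi (preimage_map x) (pre g^-1%g V) s'
  (fun S => aut_pull (@Perm_action R k n g^-1%g) (h (act_set g^-1%g S))) V'x.
  move=> S pS; have pS' : proper_subset (act_set g^-1%g S) by rewrite proper_act_set.
  by have := local_equation_pull (g := g^-1%g) (hh _ pS'); rewrite act_setK.
have t' : pre g W `<=` V by move=> y /t; rewrite /= act_pointK.
exists (pre g W), t', (aut_pull (@Perm_action R k n g) psi); split=> // y.
have [Wy ty] := set_mem (valP y).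
have hE (A : set X) (r : A `<=` V) (z : A) S : h S (incl r z) = ext (h S) (val z).
  by rewrite -extE.
have Hy := H (torus_map y).
rewrite -[RHS]extE /= ext_pull //.
rewrite [RHS](_ : _ = psi (incl (@torus_subl _ _ _ W) (torus_map y))); last first.
  by rewrite -[RHS]extE.
rewrite -Hy; congr (_ * _); first by congr phi; exact: val_inj.
rewrite [RHS](reindex_inj (can_inj (act_setK g))) /=.
rewrite [RHS](eq_bigl (@proper_subset n)); last by move=> S; exact: proper_act_set.
apply: eq_bigr => S pS; rewrite ba // hE; congr (_ ^ _).
rewrite -[RHS](extE (aut_pull (@Perm_action R k n g^-1%g) (h (act_set g^-1%g (act_set g S))))) /=.
by rewrite ext_pull /= act_pointK ?act_setK //; exact: t'.
Qed.

Section Pull.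
Variables (g : 'S_2 * 'S_n) (a b : {set 'I_n} -> int).
Hypothesis ba : forall S, proper_subset S -> b S = a (act_set g S).

Lemma div_pull_subproof U (f : div_sec a U) :
  ((div_fun f \o @torus_map g U) : torus_fun (pre g U)) \in @div_pred R k n b (pre g U).
Proof.
by rewrite inE; apply: (div_section_pull ba); have := div_mem f; rewrite inE.
Qed.

Definition div_pull U (f : div_sec a U) : div_sec b (pre g U) :=
  DivSec (div_pull_subproof f).
End Pull.

Section Push.
Variables (g : 'S_2 * 'S_n) (a b : {set 'I_n} -> int).
Hypothesis ba : forall S, proper_subset S -> b S = a (act_set g^-1%g S).

Lemma sub_pre_pre U : U `<=` pre g^-1%g (pre g U).
Proof. by move=> y Uy; rewrite /= act_pointVK. Qed.

(** Pulling back by [g^-1] gives a section on the preimage of a preimage, which has the points of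
    [U] but is a different term of type [opens]; hence the restriction. *)
Definition div_push U (f : transport_sec (@Perm_action R k n g) (@div_sheaf R k n a) U) :
  div_sec b U := div_res (@sub_pre_pre U) (div_pull ba (f : div_sec a (pre g U))).

Lemma div_push_linear U : linear (@div_push U).
Proof.
move=> c f f'; apply: val_inj; apply/funext => y.
congr (_ * _ + _); rewrite -[RHS]extE -[LHS]extE /=.
by rewrite ext_pull /= act_pointVK //; have [] := set_mem (valP y).
Qed.

HB.instance Definition _ U :=
  GRing.isLinear.Build _ _ _ _ (@div_push U) (@div_push_linear U).
End Push.

Lemma transport_div_sheaf g a b :
  (forall S, proper_subset S -> b S = a (act_set g^-1%g S)) ->
  modsheaf_iso (transport (@Perm_action R k n g) (@div_sheaf R k n a)) (@div_sheaf R k n b).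
Proof.
move=> ba.
have ab S : proper_subset S -> a S = b (act_set g S).
  by move=> pS; rewrite ba ?act_setK // proper_act_set.
exists (fun U => (div_push ba (U := U) : {linear _ -> _})).
split=> [U|U V s x]; last first.
  by apply: val_inj; apply/funext => y /=; congr (div_fun _ _); exact: val_inj.
exists (div_pull ab (U := U)) => f; apply: val_inj; apply/funext => y /=.
  by congr (div_fun _ _); apply: val_inj; rewrite /= act_pointK.
by congr (div_fun _ _); apply: val_inj; rewrite /= act_pointVK.
Qed.

End SheafIso.

(** * Schubert matroids: Gale order by counting, duality and loops *)

Section Schubert.
Variable n : nat.
Implicit Types (w : 'S_n) (S T : {set 'I_n}) (i j : 'I_n).

Definition below w T i : {set 'I_n} := [set t in T | lew w t i]%SET.

Lemma lew_trans w : transitive (lew w).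
Proof. by move=> a b c; exact: leq_trans. Qed.

Lemma lew_total w : total (lew w).
Proof. by move=> a b; exact: leq_total. Qed.

Lemma lew_refl w : reflexive (lew w).
Proof. by move=> a; exact: leqnn. Qed.

(** Termwise comparison of sorted lists is comparison of their counting functions. The heads are
    minima, so the count at the head of [t] forces the head of [s] below it. *)
Lemma all2_lewP w (s t : seq 'I_n) : size s = size t ->
  sorted (lew w) s -> sorted (lew w) t ->
  reflect (forall i, count (lew w ^~ i) t <= count (lew w ^~ i) s)%N
    (all2 (lew w) s t).
Proof.
elim: s t => [|x s IH] [|y t] //=; first by move=> *; left.
move=> [st] xs yt; have ss := path_sorted xs; have ts := path_sorted yt.
have xmin := order_path_min (@lew_trans w) xs.
have ymin := order_path_min (@lew_trans w) yt.
apply: (iffP andP) => [[xy /(IH _ st ss ts) H] i|H].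
  by apply: leq_add (H i); case yi: (lew w y i) => //; rewrite (lew_trans xy yi).
have xy : lew w x y.
  have := H y; rewrite lew_refl; case: (boolP (lew w x y)) => // nxy.
  suff -> : count (lew w ^~ y) s = 0 by [].
  apply/eqP; rewrite -leqn0 leqNgt -has_count; apply/hasPn => z zs.
  by apply: contra nxy; apply: lew_trans; exact: (allP xmin).
split=> //; apply/(IH _ st ss ts) => i; have := H i.
case yi: (lew w y i); first by rewrite (lew_trans xy yi) !add1n ltnS.
suff -> : count (lew w ^~ i) t = 0 by [].
apply/eqP; rewrite -leqn0 leqNgt -has_count; apply/hasPn => z zt.
by apply/negP => zi; rewrite (lew_trans (allP ymin _ zt) zi) in yi.
Qed.

Lemma count_sort_enum w T i :
  count (lew w ^~ i) (sort (lew w) (enum T)) = #|below w T i|.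
Proof.
rewrite (seq.permP (permEl (perm_sort _ _))) -sum1_count big_enum_cond /= sum1dep_card.
by apply: eq_card => j; rewrite !inE.
Qed.

Lemma schubertP w S T : reflect
  (#|T| = #|S| /\ forall i, #|below w T i| <= #|below w S i|)%N (T \in schubert w S).
Proof.
rewrite inE; have [TS|nTS] /= := eqVneq #|T| #|S|; last first.
  by right; case=> TS; rewrite TS eqxx in nTS.
have sz : size (sort (lew w) (enum S)) = size (sort (lew w) (enum T)).
  by rewrite !size_sort -!cardE.
have := all2_lewP sz (sort_sorted (@lew_total w) _) (sort_sorted (@lew_total w) _).
move=> P; apply: (iffP P) => [H|[_ H] i].
  by split=> // i; have := H i; rewrite !count_sort_enum.
by rewrite !count_sort_enum.
Qed.

Lemma below_segment w T i : below w T i = T :&: segment w ((w^-1)%g i).+1.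
Proof. by apply/setP => j; rewrite !inE ltnS. Qed.

Lemma schubert_segmentP w S T : reflect
  (#|T| = #|S| /\
    forall l, (l <= n)%N -> #|T :&: segment w l| <= #|S :&: segment w l|)%N
  (T \in schubert w S).
Proof.
apply: (iffP (schubertP w S T)) => -[TS H]; split=> //; last first.
  by move=> i; rewrite !below_segment; exact: H.
case=> [_|l ln]; last by have := H (w (Ordinal ln)); rewrite !below_segment permK.
rewrite [X in (X <= _)%N](_ : _ = 0) //; apply/eqP; rewrite cards_eq0.
by apply/eqP/setP => i; rewrite !inE andbF.
Qed.

Lemma schubert_refl w S : S \in schubert w S.
Proof. exact/schubertP. Qed.

(** Replacing an element by a later one can only lower the number of elements below any bound, so
    the set moves up in the Gale order. *)
Lemma schubert_exchange w S T i j : T \in schubert w S -> j \in T -> i \notin T ->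
  lew w j i -> i |: (T :\ j) \in schubert w S.
Proof.
move=> /schubertP [TS H] jT iT ji; apply/schubertP; split=> [|l].
  have iTj : i \notin T :\ j by rewrite inE negb_and iT orbT.
  by rewrite cardsU1 iTj -TS [in RHS](cardsD1 j) jT.
apply: leq_trans (H l); case il: (lew w i l).
  have jl := lew_trans ji il.
  have -> : below w (i |: (T :\ j)) l = i |: (below w T l :\ j).
    by apply/setP => a; rewrite !inE; case: eqP => [->|_] //=; rewrite andbA.
  have iB : i \notin below w T l :\ j by rewrite !inE (negPf iT) andbF.
  by rewrite cardsU1 iB [leqRHS](cardsD1 j) inE jT jl.
apply: subset_leq_card; apply/fintype.subsetP => a; rewrite !inE.
by case: eqP => [->|_] /=; [rewrite il|rewrite -andbA => /andP []].
Qed.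

Lemma order_perm (f : 'I_n -> nat) : injective f ->
  exists w, forall i j, lew w i j = (f i <= f j)%N.
Proof.
move=> inj.
have rk i : (#|[set j | f j < f i]%SET| < n)%N.
  rewrite -[X in (_ < X)%N]card_ord -cardsT; apply: proper_card.
  rewrite properT; apply/negP => /eqP /setP /(_ i).
  by rewrite !inE ltnn.
pose r i := Ordinal (rk i).
have rle i j : (r i <= r j)%N = (f i <= f j)%N.
  have [fij|fji] := leqP (f i) (f j).
    apply: subset_leq_card; apply/fintype.subsetP => a; rewrite !inE => ai.
    exact: leq_trans ai fij.
  apply/negbTE; rewrite -ltnNge; apply: proper_card; apply/properP; split.
    apply/fintype.subsetP => a; rewrite !inE => ai; exact: ltn_trans ai fji.
  by exists j; rewrite !inE ?ltnn.
have rinj : injective r.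
  move=> i j rij; apply: inj; apply/eqP.
  by rewrite eqn_leq -!rle rij leqnn.
exists ((perm rinj)^-1)%g => i j.
by rewrite /lew /= invgK !permE rle.
Qed.

Definition loops (Omega : {set {set 'I_n}}) : {set 'I_n} :=
  [set i | [forall B, (B \in Omega) ==> (i \notin B)]]%SET.

Lemma loopsP (Omega : {set {set 'I_n}}) i :
  reflect (forall B, B \in Omega -> i \notin B) (i \in loops Omega).
Proof.
rewrite inE; apply: (iffP forallP) => H B; first by move=> BO; have := H B; rewrite BO.
by apply/implyP; exact: H.
Qed.

Definition coloop_loops (Omega : {set {set 'I_n}}) : {set {set 'I_n}} :=
  [set B :|: loops Omega | B in Omega]%SET.

Lemma loopless_coloop_loops (Omega : {set {set 'I_n}}) B0 :
  B0 \in Omega -> loopless (coloop_loops Omega).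
Proof.
move=> B0O; have mem B : B \in Omega -> B :|: loops Omega \in coloop_loops Omega.
  exact: (imset_f (fun B => B :|: loops Omega)).
apply/forallP => i; apply/existsP; have [iL|] := boolP (i \in loops Omega).
  by exists (B0 :|: loops Omega); rewrite mem //= inE iL orbT.
rewrite inE negb_forall => /existsP [B]; rewrite negb_imply negbK => /andP [BO iB].
by exists (B :|: loops Omega); rewrite mem //= inE iB.
Qed.

(* The loops of a Schubert matroid come first in its order; moving them to the end turns
   them into coloops. *)
Lemma is_schubert_coloop_loops w S : is_schubert (coloop_loops (schubert w S)).
Proof.
rewrite /coloop_loops; set L := loops _.
have : forall i, reflect _ (i \in L) := loopsP (schubert w S).
move: L => L LP.
(* Adding [n] to the positions of the loops puts them after all other elements, in their old
   relative order. *)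
pose f i := if i \in L then ((w^-1)%g i + n)%N else (w^-1)%g i.
have pinj i j : (w^-1)%g i = (w^-1)%g j :> nat -> i = j by move=> /val_inj /perm_inj.
have pn i : ((w^-1)%g i < n)%N by [].
have finj : injective f.
  move=> i j; rewrite /f; have := pn i; have := pn j.
  by case: ifP => iL; case: ifP => jL ? ? ?; apply: pinj; lia.
have [w' w'E] := order_perm finj.
have disj B i : B \in schubert w S -> i \in L -> i \in B = false.
  by move=> BS /LP /(_ _ BS) /negPf.
(* The loops form an initial segment: a basis element before a loop could be exchanged for that
   loop. *)
have Ldown i j : i \in L -> lew w j i -> j \in L.
  move=> iL ji; apply/LP => B BS; apply/negP => jB.
  have iB := disj _ _ BS iL.
  have := disj _ _ (schubert_exchange BS jB (negbT iB) ji) iL.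
  by rewrite !inE eqxx.
have cardL A : #|A :|: L| = (#|A :\: L| + #|L|)%N.
  rewrite -(cardsID L) addnC; congr (_ + _)%N; apply: eq_card => i; rewrite !inE.
    by case: (i \in L); rewrite ?orbF.
  by case: (i \in L); rewrite ?orbT ?andbF.
have cardLd B : B \in schubert w S -> #|B :|: L| = (#|B| + #|L|)%N.
  move=> BS; rewrite cardL; congr addn; apply: eq_card => i; rewrite !inE.
  by case iL: (i \in L) => //=; rewrite (disj B).
have SS := schubert_refl w S.
have belowN A i : i \notin L -> below w' (A :|: L) i = below w (A :\: L) i.
  move=> iL; apply/setP => j; rewrite !inE w'E /f (negPf iL).
  case jL: (j \in L); rewrite /= ?orbF // orbT /=.
  by have := pn i; lia.
have belowL A i : i \in L -> below w' (A :|: L) i = (A :\: L) :|: below w L i.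
  move=> iL; apply/setP => j; rewrite !inE w'E /f iL.
  case jL: (j \in L); rewrite /= ?orbF ?orbT /=; first by rewrite leq_add2r.
  by case: (j \in A) => //=; have := pn j; lia.
have setDL B : B \in schubert w S -> B :\: L = B.
  move=> BS; apply/setP => i; rewrite inE.
  by case iL: (i \in L) => //=; rewrite (disj B).
have card_disjU A i : #|(A :\: L) :|: below w L i| = (#|A :\: L| + #|below w L i|)%N.
  rewrite cardsU (_ : _ :&: _ = finset.set0) ?cards0 ?subn0 //.
  by apply/setP => j; rewrite !inE; case: (j \in L); rewrite /= ?andbF.
apply/existsP; exists w'; apply/existsP; exists (S :|: L).
apply/eqP/setP => T; apply/imsetP/schubertP => [[B BS ->]|[TS H]].
  have /schubertP [BSc HB] := BS.
  split=> [|i]; first by rewrite !cardLd // BSc.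
  have [iL|iL] := boolP (i \in L); last by rewrite !belowN // !setDL.
  by rewrite !belowL // !card_disjU !setDL // BSc.
(* At the last non-loop, the Gale inequality says that [T] has at most [#|S|] non-loops; as
   [#|T| = #|S| + #|L|], it contains all loops. If every element is a loop, [T] is everything by
   cardinality. *)
have LT : L \subset T.
  have [i0 i0L|allL] := pickP [pred i | i \notin L]; last first.
    suff -> : T = [set: 'I_n]%SET by apply/fintype.subsetP => i; rewrite inE.
    apply/eqP; rewrite eqEcard cardsT TS; apply/andP; split.
      by apply/fintype.subsetP => i; rewrite inE.
    rewrite -cardsT; apply: subset_leq_card; apply/fintype.subsetP => i _.
    by rewrite inE; have /negbFE -> := allL i; rewrite orbT.
  pose i1 := [arg max_(i > i0 | i \notin L) val ((w^-1)%g i)].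
  have [i1L i1max] : i1 \notin L /\ forall j, j \notin L -> lew w j i1.
    by rewrite /i1; case: arg_maxnP => // i iL im; split.
  have := H i1.
  have bE A : below w' A i1 = A :\: L.
    apply/setP => j; rewrite !inE w'E /f (negPf i1L).
    case jL: (j \in L); rewrite /= ?andbT.
      by case: (j \in A) => //=; have := pn i1; lia.
    by have := i1max j (negbT jL); rewrite /lew /= => ->; rewrite andbT.
  rewrite !bE finset.setDUl finset.setDv finset.setU0 (setDL S) // => le.
  have := cardsID L T; have := cardLd S SS; rewrite TS => E1 E2.
  have : (#|L| <= #|T :&: L|)%N by lia.
  by move=> h; apply/finset.setIidPr/eqP; rewrite eqEcard finset.subsetIr.
have TE : T = (T :\: L) :|: L.
  by apply/setP => i; rewrite !inE; case iL: (i \in L);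
    rewrite ?orbF ?orbT //; exact: (fintype.subsetP LT).
exists (T :\: L) => //.
apply/schubertP; split=> [|i].
  by have := cardLd S SS; rewrite -TS {1}TE cardL finset.setDDl finset.setUid; lia.
have [iL|iL] := boolP (i \in L).
  rewrite [X in (X <= _)%N](_ : _ = 0) //; apply/eqP; rewrite cards_eq0.
  apply/eqP/setP => j; rewrite !inE; apply/negP => /andP [/andP [jL _] ji].
  by rewrite (Ldown i j) in jL.
have := H i; rewrite belowN // (setDL S) // {1}TE belowN //.
by rewrite finset.setDDl finset.setUid.
Qed.

(** For odd [g], an initial segment of length [l] in the new order is the image of the complement of
    the old one of length [n - l]. By inclusion-exclusion and [#|T| = #|S|], the Gale inequality for
    complements at [l] is the original one at [n - l], in the same direction. *)
Lemma act_set_schubert (g : 'S_2 * 'S_n) w S T :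
  (act_set g T \in schubert (wact g w) (act_set g S)) = (T \in schubert w S).
Proof.
have posE j : ((wact g w)^-1)%g (g.2 j) =
    if odd_perm g.1 then rev_ord ((w^-1)%g j) else (w^-1)%g j.
  apply: (@perm_inj _ (wact g w)); rewrite permKV /wact.
  by case: odd_perm; rewrite !permM ?perm1 ?permKV // permE rev_ordK permKV.
have cardN (A : {set 'I_n}) : #|A| = (n - #|~: A|)%N.
  by have := cardsC A; rewrite card_ord; lia.
have segE A l : (l <= n)%N -> #|act_set g A :&: segment (wact g w) l| =
    if odd_perm g.1 then (n - (#|A| + (n - l) - #|A :&: segment w (n - l)|))%N
    else #|A :&: segment w l|.
  move=> ln; case go: (odd_perm g.1).
    rewrite -[X in (_ + X)%N](card_segment w (leq_subr l n)) -cardsU.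
    rewrite cardN -[in RHS](card_imset _ (@perm_inj _ g.2)); congr (n - _)%N; apply: eq_card => i.
    rewrite -[i](permKV g.2) mem_imset; last exact: perm_inj.
    rewrite !inE in_act_set go permK posE go /=.
    have := ltn_ord ((w^-1)%g ((g.2^-1)%g i)).
    by case: (_ \in A) => //=; lia.
  rewrite -[in RHS](card_imset _ (@perm_inj _ g.2)); apply: eq_card => i.
  rewrite -[i](permKV g.2) mem_imset; last exact: perm_inj.
  by rewrite !inE in_act_set go permK posE go.
have cE A : #|act_set g A| = if odd_perm g.1 then (n - #|A|)%N else #|A|.
  rewrite /act_set; case: odd_perm; rewrite ?card_imset //; try exact: perm_inj.
  by rewrite cardN finset.setCK card_imset //; exact: perm_inj.
have An (A : {set 'I_n}) : (#|A| <= n)%N by rewrite -[X in (_ <= X)%N]card_ord max_card.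
have In (A B : {set 'I_n}) : (#|A :&: B| <= #|A|)%N by rewrite subset_leq_card ?finset.subsetIl.
have Il (A : {set 'I_n}) l : (l <= n)%N -> (#|A :&: segment w l| <= l)%N.
  by move=> ln; rewrite -[leqRHS](card_segment w ln) subset_leq_card ?finset.subsetIr.
have Ul (A : {set 'I_n}) l : (l <= n)%N -> (#|A| + l - #|A :&: segment w l| <= n)%N.
  by move=> ln; rewrite -[X in (_ + X - _)%N](card_segment w ln) -cardsU.
apply/schubert_segmentP/schubert_segmentP; rewrite !cE => -[TS H].
  have eTS : #|T| = #|S|.
    have := An T; have := An S; move: TS; case: odd_perm => //.
    by move: #|T| #|S| => t s; lia.
  split=> // l ln; have ln' : (n - l <= n)%N by lia.
  have := H (n - l)%N ln'; have := H l ln; rewrite !segE // !subKn //.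
  have := Ul T l ln; have := Ul S l ln; have := In T (segment w l).
  have := In S (segment w l); have := Il T l ln; have := Il S l ln.
  case: odd_perm => //; rewrite eTS.
  by move: #|T :&: segment w l| #|S :&: segment w l| #|S| => x y s; lia.
split=> [|l ln]; first by rewrite TS.
have ln' : (n - l <= n)%N by lia.
rewrite !segE //; have := H l ln; have := H _ ln'; case: odd_perm => //; rewrite TS.
move: #|T :&: segment w (n - l)| #|S :&: segment w (n - l)| => x y; lia.
Qed.
End Schubert.

(** * Support functions and base polytopes under affine maps *)

Section Polytope.
Local Open Scope classical_set_scope.
Local Open Scope ring_scope.
Variables (R : realType) (n : nat).
Implicit Types (P : set 'rV[R]_n) (S T : {set 'I_n}) (m : 'rV[int]_n).
Implicit Types (g : 'S_2 * 'S_n) (Omega : {set {set 'I_n}}).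

Definition coord_sum S (x : 'rV[R]_n) : R := \sum_(i in S) x 0 i.

Lemma coord_sumD S x y : coord_sum S (x + y) = coord_sum S x + coord_sum S y.
Proof. by rewrite /coord_sum -big_split; apply: eq_bigr => i _; rewrite mxE. Qed.

Lemma coord_sum_intr S m : coord_sum S (map_mx intr m) = (msum m S)%:~R.
Proof. by rewrite /coord_sum /msum rmorph_sum; apply: eq_bigr => i _; rewrite mxE. Qed.

(** For odd [g] this uses the zero sum: minus the sum over a set is the sum over its complement. *)
Lemma coord_sum_gact g S (x : 'rV[R]_n) : \sum_i x 0 i = 0 ->
  coord_sum S (gact g x) = coord_sum (act_set g^-1%g S) x.
Proof.
move=> x0; have -> : coord_sum S (gact g x) =
    (-1) ^+ odd_perm g.1 * \sum_(i | g.2 i \in S) x 0 i.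
  rewrite /coord_sum (reindex_inj (@perm_inj _ g.2)) mulr_sumr.
  by apply: eq_bigr => i _; rewrite mxE permK.
rewrite /coord_sum [RHS](eq_bigl (fun i => odd_perm g.1 (+) (g.2 i \in S))); last first.
  by move=> i; rewrite in_act_set /= odd_permV invgK.
case: odd_perm => /=; last by rewrite expr0 mul1r.
apply/eqP; rewrite expr1 mulN1r eq_sym -subr_eq0 opprK addrC; apply/eqP.
by rewrite -[RHS]x0 [RHS](bigID (fun i => g.2 i \in S)).
Qed.

Lemma support_coef_translate P S m : has_sup [set coord_sum S x | x in P] ->
  support_coef [set x + map_mx intr m | x in P] S = support_coef P S + msum m S.
Proof.
move=> hs; rewrite /support_coef.
have -> : [set \sum_(i in S) x 0 i | x in [set x + map_mx intr m | x in P]] =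
    [set u + v | u in [set coord_sum S x | x in P] & v in [set (msum m S)%:~R]].
  apply/seteqP; split=> [_ [_ [x Px <-] <-]|_ [_ [x Px <-]] [_ -> <-]].
    exists (coord_sum S x); first by exists x.
    by exists (msum m S)%:~R => //; rewrite -coord_sum_intr -coord_sumD.
  exists (x + map_mx intr m); first by exists x.
  by rewrite -coord_sum_intr -coord_sumD.
have h1 : has_sup [set ((msum m S)%:~R : R)].
  by split; exists (msum m S)%:~R => // _ ->.
by rewrite sup_sumE // sup1 floorDrz ?intr_int // intrKfloor.
Qed.

Lemma support_coef_gact g P S : P `<=` [set x | \sum_i x 0 i = 0] ->
  support_coef (gact g @` P) S = support_coef P (act_set g^-1%g S).
Proof.
move=> P0; rewrite /support_coef; congr (Num.floor (sup _)).
apply/seteqP; split=> [_ [_ [x Px <-] <-]|_ [x Px <-]].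
  by exists x => //; exact: esym (coord_sum_gact g S (P0 _ Px)).
exists (gact g x); first by exists x.
exact: coord_sum_gact (P0 _ Px).
Qed.

Lemma base_polytope_has_sup Omega S m B0 : B0 \in Omega ->
  has_sup [set coord_sum S x | x in [set x + map_mx intr m | x in @base_polytope R n Omega]].
Proof.
move=> B0O; split.
  exists (coord_sum S (indic R B0 + map_mx intr m)), (indic R B0 + map_mx intr m) => //.
  exists (indic R B0) => //; exists (fun B => (B == B0)%:R); split.
  - by move=> B _; exact: ler0n.
  - rewrite (bigD1 B0) //= eqxx big1 ?addr0 // => B /andP [_ /negPf ->] //.
  rewrite (bigD1 B0) //= eqxx scale1r big1 ?addr0 // => B /andP [_ /negPf ->].
  by rewrite scale0r.
exists (coord_sum S (const_mx 1) + (msum m S)%:~R).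
move=> _ [_ [x [c [c0 c1 ->]] <-] <-]; rewrite coord_sumD coord_sum_intr lerD2r.
apply: ler_sum => i _; rewrite summxE [leRHS]mxE -c1; apply: ler_sum => B BO.
by rewrite !mxE; case: (i \in B); rewrite ?mulr1 ?mulr0 // c0.
Qed.

(** An affine map commutes with convex combinations, since the coefficients sum to 1; it therefore
    suffices to follow the vertices. *)
Lemma base_polytope_image Omega g (phi : {set 'I_n} -> {set 'I_n}) (v : 'rV[R]_n) :
  {in Omega &, injective phi} ->
  (forall B, B \in Omega -> indic R (phi B) = gact g (indic R B) + v) ->
  @base_polytope R n (phi @: Omega) = [set gact g x + v | x in @base_polytope R n Omega].
Proof.
move=> inj phiE.
have sumE (c : {set 'I_n} -> R) : \sum_(B in Omega) c B = 1 ->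
    gact g (\sum_(B in Omega) c B *: indic R B) + v =
    \sum_(B in Omega) c B *: indic R (phi B).
  move=> c1; have -> : \sum_(B in Omega) c B *: indic R (phi B) =
      \sum_(B in Omega) c B *: (gact g (indic R B) + v).
    by apply: eq_bigr => B BO; rewrite phiE.
  under [RHS]eq_bigr do rewrite scalerDr.
  rewrite big_split /= -scaler_suml c1 scale1r; congr (_ + _).
  apply/rowP => i; rewrite mxE !summxE mulr_sumr; apply: eq_bigr => B _.
  by rewrite !mxE mulrCA.
apply/seteqP; split=> [x [c [c0 c1 ->]]|_ [_ [c [c0 c1 ->]] <-]].
  exists (\sum_(B in Omega) c (phi B) *: indic R B).
    exists (c \o phi); split=> // [B BO|]; first by apply: c0; exact: imset_f.
    by rewrite -c1 big_imset.
  by rewrite (sumE (c \o phi)) ?big_imset // -c1 big_imset.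
(* A left inverse of [phi] on [Omega]; the default value is never reached on the image of
   [Omega]. *)
pose psi T := odflt T [pick B in Omega | phi B == T].
have psiK B : B \in Omega -> psi (phi B) = B.
  move=> BO; rewrite /psi; case: pickP => [A /andP [AO /eqP AB]|/(_ B)] /=.
    exact: inj.
  by rewrite BO eqxx.
exists (c \o psi); split.
- by move=> _ /imsetP [B BO ->]; rewrite /= psiK // c0.
- by rewrite big_imset //= -c1; apply: eq_bigr => B BO; rewrite psiK.
by rewrite sumE // big_imset //=; apply: eq_bigr => B BO; rewrite psiK.
Qed.

End Polytope.

(** * The action on loopless Schubert matroids and their support coefficients *)

Section Dual.
Local Open Scope classical_set_scope.
Local Open Scope ring_scope.
Variables (R : realType) (n : nat).
Implicit Types (g : 'S_2 * 'S_n) (Omega : {set {set 'I_n}}).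

Definition act_matroid g Omega : {set {set 'I_n}} :=
  coloop_loops [set act_set g B | B in Omega]%SET.

Lemma act_set_imset_schubert g w S :
  [set act_set g B | B in schubert w S]%SET = schubert (wact g w) (act_set g S).
Proof.
apply/setP => T; apply/imsetP/idP => [[B BS ->]|TS]; first by rewrite act_set_schubert.
exists (act_set g^-1%g T); last by rewrite act_setVK.
by rewrite -(act_set_schubert g) act_setVK.
Qed.

Lemma act_matroid_loopless_schubert g Omega : is_schubert Omega ->
  is_schubert (act_matroid g Omega) && loopless (act_matroid g Omega).
Proof.
move=> /existsP [w /existsP [S /eqP ->]].
rewrite /act_matroid act_set_imset_schubert is_schubert_coloop_loops.
exact: loopless_coloop_loops (schubert_refl _ _).
Qed.

Lemma base_polytope_act_matroid g Omega : exists m : 'rV[int]_n,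
  @base_polytope R n (act_matroid g Omega) =
  [set gact g x + map_mx intr m | x in @base_polytope R n Omega].
Proof.
set L := loops [set act_set g B | B in Omega]%SET.
have disj B i : B \in Omega -> i \in act_set g B -> i \in L = false.
  by move=> BO iB; apply/negP => /loopsP /(_ _ (imset_f _ BO)); rewrite iB.
(* The first term comes from [e_(gB) = g e_B + (1,..,1)] for odd [g]; the second is [e_L], added
   because the loops [L] are disjoint from every [gB]. *)
exists (\row_i ((odd_perm g.1 : nat)%:R + (i \in L : nat)%:R)).
have -> : act_matroid g Omega = [set act_set g B :|: L | B in Omega]%SET.
  by rewrite /act_matroid /coloop_loops -imset_comp.
apply: base_polytope_image => [A B AO BO AB|B BO].
  apply: (can_inj (act_setK g)); apply/setP => i; move/setP: AB => /(_ i).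
  rewrite !finset.in_setU; case iA: (i \in act_set g A); case iB: (i \in act_set g B) => //=.
    by rewrite (disj A).
  by rewrite (disj B).
apply/rowP => i; rewrite !mxE finset.in_setU in_act_set; have := disj B i BO; rewrite in_act_set.
case: odd_perm; case: (_ \in B) => /=; case: (i \in L) => //; try by move=> /(_ isT).
all: move=> _; rewrite /= ?expr1 ?expr0; lra.
Qed.

Lemma support_coef_act_matroid g Omega P P' B0 : B0 \in Omega ->
  translate_in_M (@base_polytope R n Omega) P ->
  translate_in_M (@base_polytope R n (act_matroid g Omega)) P' ->
  exists2 m, latticeM m & forall S,
    support_coef P' S = support_coef P (act_set g^-1%g S) + msum m S.
Proof.
move=> B0O [[t PE] P0] [[t' P'E] P'0].
have [v vE] := base_polytope_act_matroid g Omega.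
(* This choice makes [P'] the translate of [g P] by [m]. As [P] is nonempty and both [P] and [P']
   lie in the zero-sum hyperplane, [m] has zero sum. *)
pose m := v + t' - gact g t.
have mE : map_mx intr m = map_mx intr v + map_mx intr t' - gact g (map_mx intr t) :> 'rV[R]_n.
  by apply/rowP => i; rewrite /m !mxE intrB intrD intrM rmorph_sign.
have gactB x : gact g (x + map_mx intr t) + map_mx intr m =
    gact g x + map_mx intr v + map_mx intr t' :> 'rV[R]_n.
  by rewrite gactD mE -addrA [gact g (map_mx _ _) + _]addrC subrK addrA.
have P'E2 : P' = [set x + map_mx intr m | x in gact g @` P].
  rewrite P'E PE vE; apply/seteqP; split.
    move=> _ [_ [x xP <-] <-]; exists (gact g (x + map_mx intr t)); last by rewrite gactB.
    by exists (x + map_mx intr t) => //; exists x.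
  move=> _ [_ [_ [x xP <-] <-] <-]; exists (gact g x + map_mx intr v); last by rewrite gactB.
  by exists x.
have hs S := @base_polytope_has_sup R n Omega S t B0 B0O.
have gP S : [set coord_sum S x | x in gact g @` P] = [set coord_sum (act_set g^-1%g S) x | x in P].
  apply/seteqP; split=> [_ [_ [x Px <-] <-]|_ [x Px <-]].
    by exists x => //; rewrite coord_sum_gact //; exact: P0.
  by exists (gact g x); [exists x|rewrite coord_sum_gact //; exact: P0].
exists m => [|S]; last first.
  rewrite P'E2 support_coef_translate ?support_coef_gact // gP PE; exact: hs.
have [[_ [x Px _]] _] := hs finset.set0; rewrite -PE in Px.
have : P' (gact g x + map_mx intr m) by rewrite P'E2; exists (gact g x) => //; exists x.
move=> /P'0 /= H; apply/eqP; rewrite -(intr_eq0 R) rmorph_sum /=.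
have gx0 : \sum_i (gact g x) 0 i = 0.
  under eq_bigr do rewrite mxE.
  rewrite -mulr_sumr (reindex_inj (@perm_inj _ g.2)) /=.
  by under eq_bigr do rewrite permK; rewrite (P0 _ Px) mulr0.
apply/eqP; transitivity (\sum_i (gact g x) 0 i + \sum_i (m 0 i)%:~R).
  by rewrite gx0 add0r.
by rewrite -[RHS]H -big_split; apply: eq_bigr => i _; rewrite [RHS]mxE;
  congr (_ + _); rewrite [RHS]mxE.
Qed.
End Dual.

(** * Invariance of the collection *)

Theorem proposition1p6 (R : realType) (k : closedFieldType)
    (hk : [pchar k]%R =i pred0) (n : nat) (hn : (1 <= n)%N)
    (P' : loopless_schubert n -> set 'rV[R]_n)
    (hP' : forall Omega : loopless_schubert n,
        translate_in_M (base_polytope (val Omega)) (P' Omega)) :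
  invariant_collection (@Perm_action R k n)
    (fun Omega : loopless_schubert n => polytope_line_bundle k (P' Omega)).
Proof.
move=> g Omega; have /andP [OmS _] := valP Omega.
have OmS' := act_matroid_loopless_schubert g OmS.
pose Omega' : loopless_schubert n := exist _ (act_matroid g (val Omega)) OmS'.
have [B BO] : exists B, B \in val Omega.
  have /existsP [w /existsP [S /eqP ->]] := OmS; exists S; exact: schubert_refl.
have [m mM mE] := support_coef_act_matroid BO (hP' Omega) (hP' Omega').
pose a S := support_coef (P' Omega) (act_set g^-1%g S).
exists Omega'; apply: (@modsheaf_iso_trans _ _ _ (@div_sheaf R k n a)).
  exact: transport_div_sheaf.
(* The exponent is [- m] because multiplication by [chi^m] lowers the coefficients by [msum m S],
   whereas here they must grow by that amount. *)
apply: (@div_sheaf_chi _ _ _ _ _ (- m)%R hk (latticeMN mM)) => S _.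
by rewrite msumN GRing.opprK mE.
Qed.
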